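(* There exist constants $\alpha>1$ and $0<\beta<1$ such that the following holds. Let $H$ be a pseudoexpander with a sufficiently large number $n=|V(H)|$ of vertices, let $d\le \log n/10^5$, and let $Z$ be a uniform read-$d$-times non-deterministic branching program computing $\phi_H$. Then $|Z|\ge \alpha^{n^{\beta}}$.
   Context: Logarithms are base 2. A set of literals never contains both a variable and its negation; $Vars(S)$ is the set of variables occurring in $S$; $S$ represents the assignment setting positively occurring variables to true and negatively occurring ones to false. A rooted tree is extended if none of its leaves has a sibling. A graph $H$ is a binary tree based graph if it is the edge-disjoint union of extended rooted trees $T_1,\dots,T_m$ with roots $t_1,\dots,t_m$ (the roots of $H$, forming ${\bf Roots}(H)$) such that every vertex of ${\bf Leaves}(H)$ (the set of all leaves of the $T_i$) is a leaf of exactly two of the trees, and any two of the trees have at most one common vertex, which is then a leaf of both. Write $n=|V(H)|$, $m=|{\bf Roots}(H)|$. $T_i,T_j$ are adjacent if they share a leaf, denoted $\ell_{i,j}$; $P_{i,j}$ is the unique path between $t_i$ and $t_j$ in $T_i\cup T_j$. A pseudoedge is a pair $\{t_i,t_j\}$ with $T_i,T_j$ adjacent; a pseudomatching is a set of pairwise disjoint pseudoedges; it is between disjoint $U,V\subseteq{\bf Roots}(H)$ if each of its pseudoedges has one end in $U$ and one in $V$. $H$ is a pseudoexpander if (1) each $T_i$ has height (largest number of vertices on a root-leaf path) at most $(\log m)/4.9+3$, and (2) for any two disjoint $U,V\subseteq {\bf Roots}(H)$ with $|U|,|V|\ge m^{0.999}$ there is a pseudomatching between $U$ and $V$ of size at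 least $m^{0.999}/3$. The CNF $\phi_H$ has variable set $V(H)$ and, for each pseudoedge $\{t_i,t_j\}$, a clause $C_{i,j}$ whose literals are the positive literals of the vertices of $P_{i,j}$. A non-deterministic branching program (NBP) $Z$ is a directed acyclic multigraph with one source and one sink, some of whose edges are labelled with literals; $Vars(Z)$ is the set of variables labelling its edges. A source-sink path $P$ is computational if no variable occurs on it both positively and negatively; $A(P)$ is the set of literals labelling $P$. $Z$ computes the function on $Vars(Z)$ whose satisfying assignments are exactly the total assignments $S$ such that $A(P)\subseteq S$ for some computational path $P$. $|Z|$ is the number of vertices. $Z$ is a read-$d$-times NBP if each variable labels at most $d$ edges of each source-sink path, and it is uniform if each variable labels exactly $d$ edges of each source-sink path. *)

(* Defs.v *)
From mathcomp Require Import all_boot.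
From Stdlib Require Import Reals.

Set Implicit Arguments.
Unset Strict Implicit.
Unset Printing Implicit Defensive.

Definition log2 (x : R) : R := (ln x / ln 2)%R.

(* Rooted trees inside a finite vertex type V, given by a vertex set,  *)
(* a root and a parent function (the parent of a non-root vertex v is  *)
(* rt_par v; the tree edges are {v, rt_par v} for v <> root).          *)
Record rtree (V : finType) := RTree {
  rt_verts : {set V};
  rt_root : V;
  rt_par : V -> V }.

Section Trees.
Variable V : finType.
Implicit Type T : rtree V.

Definition rtree_wf T : Prop :=
  rt_root T \in rt_verts T /\
  (forall v, v \in rt_verts T -> v != rt_root T -> rt_par T v \in rt_verts T) /\
  (forall v, v \in rt_verts T -> exists k, iter k (rt_par T) v = rt_root T).

Definition children T (v : V) : {set V} :=
  [set u in rt_verts T | (u != rt_root T) && (rt_par T u == v)].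

Definition leaves T : {set V} :=
  [set v in rt_verts T | children T v == set0].

Definition extended T : Prop :=
  forall l, l \in leaves T -> l != rt_root T -> #|children T (rt_par T l)| = 1%N.

Definition tedge T (x y : V) : bool :=
  [&& x \in rt_verts T, x != rt_root T & rt_par T x == y] ||
  [&& y \in rt_verts T, y != rt_root T & rt_par T y == x].

(* height (number of vertices on the longest root-leaf path) is at most h *)
Definition height_le T (h : R) : Prop :=
  forall l, l \in leaves T ->
    exists k : nat, (INR k.+1 <= h)%R /\ iter k (rt_par T) l = rt_root T.

Definition on_root_path T (v u : V) : Prop :=
  exists k : nat, u = iter k (rt_par T) v /\
    (forall j, (j < k)%N -> iter j (rt_par T) v <> rt_root T).

End Trees.

(* Binary tree based graphs: H given by its trees T_0, ..., T_{m-1}.   *)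
Section BTBG.
Variables (V : finType) (m : nat) (T : 'I_m -> rtree V).

Definition VH : {set V} := \bigcup_(i < m) rt_verts (T i).
Definition LeavesH : {set V} := \bigcup_(i < m) leaves (T i).
Definition RootsH : {set V} := [set rt_root (T i) | i : 'I_m].

Definition is_btbg : Prop :=
  (forall i, rtree_wf (T i)) /\
  (forall i, extended (T i)) /\
  (forall i j, i != j -> forall x y, tedge (T i) x y -> ~~ tedge (T j) x y) /\
  (* the roots t_1, ..., t_m are distinct, so m = |Roots(H)| *)
  injective (fun i => rt_root (T i)) /\
  (forall l, l \in LeavesH -> #|[set i | l \in leaves (T i)]| = 2%N) /\
  (forall i j, i != j ->
     (#|rt_verts (T i) :&: rt_verts (T j)| <= 1)%N /\
     (forall v, v \in rt_verts (T i) :&: rt_verts (T j) ->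
        v \in leaves (T i) /\ v \in leaves (T j))).

Definition adjacent (i j : 'I_m) : bool :=
  (i != j) && [exists l, (l \in leaves (T i)) && (l \in leaves (T j))].

(* v is a vertex of P_{i,j}, the path between t_i and t_j in T_i u T_j:   *)
(* it consists of the root paths of the common leaf l_{i,j} in T_i and T_j *)
Definition on_P (i j : 'I_m) (v : V) : Prop :=
  exists l, l \in leaves (T i) /\ l \in leaves (T j) /\
    (on_root_path (T i) l v \/ on_root_path (T j) l v).

(* pseudomatching between U and W (sets of roots, given by tree indices): *)
(* M is a set of pseudoedges {t_i, t_j} (i in U, j in W), pairwise disjoint *)
Definition pseudomatching_between (U W : {set 'I_m}) (M : {set 'I_m * 'I_m}) : Prop :=
  (forall p, p \in M -> [/\ p.1 \in U, p.2 \in W & adjacent p.1 p.2]) /\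
  (forall p q, p \in M -> q \in M -> p != q ->
     [/\ p.1 != q.1, p.2 != q.2, p.1 != q.2 & p.2 != q.1]).

Definition pseudoexpander : Prop :=
  (forall i, height_le (T i) (log2 (INR m) / (49/10) + 3)%R) /\
  (forall U W : {set 'I_m}, [disjoint U & W] ->
     (Rpower (INR m) (999/1000) <= INR #|U|)%R ->
     (Rpower (INR m) (999/1000) <= INR #|W|)%R ->
     exists M, pseudomatching_between U W M /\
       (Rpower (INR m) (999/1000) / 3 <= INR #|M|)%R).

(* the CNF phi_H evaluated at a total assignment S : one clause C_{i,j} *)
(* (positive literals of the vertices of P_{i,j}) per pseudoedge        *)
Definition phi (S : V -> bool) : Prop :=
  forall i j : 'I_m, (i < j)%N -> adjacent i j ->
    exists v, on_P i j v /\ S v = true.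

End BTBG.

(* vertices W, edges E (multigraph), labels: optional literals, where  *)
(* a literal (x, b) is x if b = true and the negation of x otherwise.  *)
Record nbp (V W E : finType) := NBP {
  esrc : E -> W;
  etgt : E -> W;
  elab : E -> option (V * bool);
  source : W;
  sink : W }.

Section NBP.
Variables (V W E : finType) (Z : nbp V W E).

Fixpoint walk (u : W) (es : seq E) (v : W) : Prop :=
  match es with
  | [::] => u = v
  | e :: es' => esrc Z e = u /\ walk (etgt Z e) es' v
  end.

Definition nbp_wf : Prop :=
  (forall u es, walk u es u -> es = [::]) /\
  (forall w, (forall e, etgt Z e != w) <-> w = source Z) /\
  (forall w, (forall e, esrc Z e != w) <-> w = sink Z).

Definition ss_path (es : seq E) : Prop := walk (source Z) es (sink Z).

Definition lits (es : seq E) : seq (V * bool) := pmap (elab Z) es.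

Definition computational (es : seq E) : Prop :=
  forall x, ~ ((x, true) \in lits es /\ (x, false) \in lits es).

Definition Vars : {set V} :=
  [set x | [exists e, if elab Z e is Some l then l.1 == x else false]].

Definition var_count (x : V) (es : seq E) : nat :=
  count (fun l : V * bool => l.1 == x) (lits es).

Definition read_times (d : nat) : Prop :=
  forall es, ss_path es -> forall x, (var_count x es <= d)%N.

Definition uniform_read (d : nat) : Prop :=
  forall es, ss_path es -> forall x, x \in Vars -> var_count x es = d.

Definition computes (X : {set V}) (f : (V -> bool) -> Prop) : Prop :=
  Vars = X /\
  forall S : V -> bool,
    f S <-> exists es, [/\ ss_path es, computational es &
                          forall l, l \in lits es -> S l.1 = l.2].

End NBP.

(* Main.v *)
Require Import Defs.
From Stdlib Require Import Reals Lra.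
From mathcomp Require Import all_boot zify.

(* zify rebinds %R to ring_scope. *)
Delimit Scope R_scope with R.

(* Each clause C_{i,j} contains the leaf l_{i,j}, which lies on no other P_{k,l}.
   Setting leaves to true therefore deletes clauses at will; with all other
   non-root vertices false, phi_H restricts to the 2-CNF "t_i or t_j" over any
   chosen set G of pseudoedges, and the sets I of false roots are the independent
   sets of G.  The expansion property yields many pseudoedges between large
   disjoint U and U', so a random sample G of about m^(2 - c) pseudoedges still meets every pair of
   disjoint root sets of size >= s = m / 4^(d+1).  G is so sparse that the range
   of a uniformly random t-tuple v of roots, with t = m^c', is independent with
   probability at least 1/2.

   Cut an accepting path for v into r + 1 = O(d^2) segments with few root reads
   each.  As Z is uniform, the cut vertices determine which roots are read in
   which segments, and some set A of segments leaves at least 2s roots U read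
   only inside A and at least 2s roots U' read only outside A.  Exchanging
   segments between two paths with the same cuts shows that, once the entries of
   v outside U and U' are fixed, the entries in U and those in U' vary
   independently; no pair of G joins them, so on one side they miss at least s
   roots.  Hence at most (m - s)^t tuples share given cuts, which forces
   m^t <= 2 |W|^(r+2) (m - s)^t.

   The tree heights enter only through |V(H)| <= 4 m^3. *)

Set Implicit Arguments.
Unset Strict Implicit.
Unset Printing Implicit Defensive.

(** * Finite combinatorics *)

(** Union bound over [N] independent uniform samples from [E]: at most [(#|E| - e) ^ N] sequences
    miss a given [S j], so some sequence misses none of them, and [G] is its range. *)
Lemma hitting_set (E J : finType) (P : pred J) (S : J -> {set E}) (e N : nat) :
  (forall j, P j -> e <= #|S j|) ->
  #|J| * (#|E| - e) ^ N < #|E| ^ N ->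
  exists2 G : {set E}, #|G| <= N & forall j, P j -> exists2 x, x \in S j & x \in G.
Proof.
move=> S_ge ltN.
have [f fP] : exists f : {ffun 'I_N -> E}, forall j, P j -> exists k, f k \in S j.
  have [f hf|none] := pickP (fun f : {ffun 'I_N -> E} =>
                 [forall (j | P j), exists k, f k \in S j]).
    by exists f => j Pj; apply/existsP; exact: (implyP (forallP hf j)).
  suff: #|E| ^ N <= #|J| * (#|E| - e) ^ N by rewrite leqNgt ltN.
  have <- : #|{ffun 'I_N -> E}| = #|E| ^ N by rewrite card_ffun card_ord.
  rewrite -[leqLHS]cardsT.
  have sub : [set: {ffun 'I_N -> E}] \subset
      \bigcup_(j | P j) [set f : {ffun 'I_N -> E} | f \in ffun_on (mem (~: S j))].
    apply/subsetP => f _; move: (none f) => /= /negbT.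
    rewrite negb_forall => /existsP[j]; rewrite negb_imply => /andP[Pj].
    rewrite negb_exists => /forallP hk; apply/bigcupP; exists j => //.
    by rewrite inE; apply/ffun_onP => k; rewrite inE.
  apply: leq_trans (subset_leq_card sub) _.
  have union_bound : #|\bigcup_(j | P j) [set f : {ffun 'I_N -> E} | f \in ffun_on (mem (~: S j))]|
      <= \sum_(j | P j) (#|E| - e) ^ N.
    elim/big_ind2: _ => [|x1 x2 y1 y2 h1 h2|j Pj]; first by rewrite cards0.
      by rewrite (leq_trans (leq_card_setU _ _)) // leq_add.
    rewrite cardsE card_ffun_on card_ord.
    have le1 : #|~: S j| <= #|E| - e by rewrite cardsCs setCK leq_sub2l // S_ge.
    by case: (N) => [|N']; rewrite ?expn0 // leq_exp2r.
  apply: leq_trans union_bound _.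
  by rewrite sum_nat_const leq_mul2r max_card orbT.
exists [set f k | k : 'I_N].
  by apply: leq_trans (leq_imset_card _ _) _; rewrite card_ord.
by move=> j /fP[k fk]; exists (f k) => //; apply: imset_f.
Qed.

(** Membership in [A] is free outside [S1 :|: S2], which has at most [2 * d] elements; so a
    uniformly random [A] separates the two sets with probability at least [4 ^ -d]. *)
Lemma card_between (I : finType) (S1 S2 : {set I}) (d : nat) :
  #|S1| <= d -> #|S2| <= d -> [disjoint S1 & S2] ->
  2 ^ #|I| <= 4 ^ d * #|[set A : {set I} | (S1 \subset A) && (S2 \subset ~: A)]|.
Proof.
move=> S1d S2d dis.
pose D := S1 :|: S2.
have le1 : #|powerset (~: D)| <= #|[set A : {set I} | (S1 \subset A) && (S2 \subset ~: A)]|.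
  rewrite -(card_in_imset (f := fun B : {set I} => B :|: S1) (D := mem (powerset (~: D)))).
    apply: subset_leq_card; apply/subsetP => A /imsetP[B]; rewrite !inE => BD ->.
    rewrite subsetUr /= setCU subsetI -!disjoints_subset (disjoint_sym S2 S1) dis andbT.
    by rewrite disjoint_sym disjoints_subset (subset_trans BD) // setCS subsetUr.
  move=> B C; rewrite !inE => BD CD eqBC.
  have key (X : {set I}) : X \subset ~: D -> (X :|: S1) :\: S1 = X.
    move=> XD; rewrite setDUl setDv setU0; apply/setDidPl.
    by rewrite disjoints_subset (subset_trans XD) // setCS subsetUl.
  by rewrite -(key B) // eqBC key.
have cD : #|D| <= d + d by rewrite (leq_trans (leq_card_setU _ _)) // leq_add.
apply: leq_trans (leq_mul (leqnn _) le1); rewrite card_powerset.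
have -> : 4 ^ d = 2 ^ (d + d) by rewrite -[4]/(2 ^ 2) -expnM mul2n addnn.
rewrite -expnD leq_exp2l // -(cardsC D) leq_add2r //.
Qed.

(** First moment over a random [A]. At most [#|I| * (d * q)] ordered pairs have intersecting sets;
    each other pair is separated by [A] with probability at least [4 ^ -d]. The product on the right
    counts the pairs separated by [A], and some [A] reaches the average. *)
Lemma double_count_split (I K : finType) (S : I -> {set K}) (d q : nat) :
  (forall i, #|S i| <= d) -> (forall k, #|[set i | k \in S i]| <= q) ->
  exists A : {set K},
    #|I| * #|I| - #|I| * (d * q) <=
    4 ^ d * (#|[set i | S i \subset A]| * #|[set i | S i \subset ~: A]|).
Proof.
move=> Sd Sq.
pose goodp := [set p : I * I | [disjoint S p.1 & S p.2]].
have bad_le : #|~: goodp| <= #|I| * (d * q).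
  have -> : #|~: goodp| = \sum_i #|[set j | ~~ [disjoint S i & S j]]|.
    rewrite -sum1_card (eq_bigl (fun p : I * I => true && ~~ [disjoint S p.1 & S p.2])).
      rewrite -(pair_big_dep xpredT (fun i j => ~~ [disjoint S i & S j]) (fun _ _ => 1)) /=.
      by apply: eq_bigr => i _; rewrite -sum1_card; apply: eq_bigl => j; rewrite inE.
    by move=> p; rewrite !inE.
  rewrite -sum_nat_const; apply: leq_sum => i _.
  have sub : [set j | ~~ [disjoint S i & S j]] \subset \bigcup_(k in S i) [set j | k \in S j].
    apply/subsetP => j; rewrite inE => /pred0Pn[k /andP[ki kj]].
    by apply/bigcupP; exists k; rewrite ?inE.
  apply: leq_trans (subset_leq_card sub) _.
  apply: (@leq_trans (\sum_(k in S i) q)).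
    elim/big_ind2: _ => [|x1 x2 y1 y2 h1 h2|k _]; first by rewrite cards0.
      by rewrite (leq_trans (leq_card_setU _ _)) // leq_add.
    exact: Sq.
  by rewrite sum_nat_const leq_mul2r Sd orbT.
have good_ge : #|I| * #|I| - #|I| * (d * q) <= #|goodp|.
  by rewrite leq_subLR -card_prod -(cardsC goodp) addnC leq_add2r.
case: (pickP [pred A : {set K} | #|goodp| <=
    4 ^ d * (#|[set i | S i \subset A]| * #|[set i | S i \subset ~: A]|)]) => [A /= hA|none].
  by exists A; apply: leq_trans hA.
exfalso.
have total : \sum_(A : {set K})
   #|[set i | S i \subset A]| * #|[set i | S i \subset ~: A]| =
   \sum_(p : I * I) #|[set A : {set K} | (S p.1 \subset A) && (S p.2 \subset ~: A)]|.
  transitivity (\sum_(A : {set K}) \sum_(p : I * I) ((S p.1 \subset A) && (S p.2 \subset ~: A) : nat)).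
    apply: eq_bigr => A _; rewrite -cardsX -sum1_card big_mkcond /=.
    by apply: eq_bigr => -[i j] _; rewrite !inE /=; case: (_ && _).
  rewrite exchange_big; apply: eq_bigr => p _.
  rewrite -sum1_card [RHS]big_mkcond /=; apply: eq_bigr => A _; rewrite inE.
  by case: (_ && _).
have lower : #|goodp| * 2 ^ #|K| <= 4 ^ d * \sum_(p : I * I)
    #|[set A : {set K} | (S p.1 \subset A) && (S p.2 \subset ~: A)]|.
  rewrite -sum_nat_const big_distrr /= [leqRHS](bigID (mem goodp)) /=.
  apply: leq_trans (leq_addr _ _); apply: leq_sum => p; rewrite inE => dis.
  exact: card_between.
have upper : 4 ^ d * \sum_(A : {set K})
   #|[set i | S i \subset A]| * #|[set i | S i \subset ~: A]| < #|goodp| * 2 ^ #|K|.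
  have -> : #|goodp| * 2 ^ #|K| = \sum_(A : {set K}) #|goodp|.
    rewrite sum_nat_const mulnC; congr (_ * _).
    by rewrite -[RHS]cardsT -powersetT card_powerset cardsT.
  rewrite big_distrr /=.
  (* One term, at the empty set, is kept strict so that the sum is strict. *)
  rewrite (bigD1 set0) //= [ltnRHS](bigD1 set0) //= -addSn leq_add //.
    by move: (none set0) => /= /negbT; rewrite -ltnNge.
  apply: leq_sum => A _; apply: ltnW.
  by move: (none A) => /= /negbT; rewrite -ltnNge.
by rewrite total in upper; move: (leq_ltn_trans lower upper); rewrite ltnn.
Qed.

Lemma sum_option (I : finType) (F : option I -> nat) :
  \sum_o F o = F None + \sum_i F (Some i).
Proof.
rewrite (bigD1 None) //=; congr (_ + _).
rewrite -(big_imset F (h := Some) (A := predT)) /=; last by move=> x y _ _ [].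
apply: eq_bigl => -[i|] /=.
  by apply/esym/imsetP; exists i.
by apply/esym/negbTE/imsetP => -[].
Qed.

Lemma subset_of_card (I : finType) (U : {set I}) b : b <= #|U| ->
  exists2 U0 : {set I}, U0 \subset U & #|U0| = b.
Proof.
move=> bU; have : 0 < #|[set A : {set I} | A \subset U & #|A| == b]|.
  by rewrite cards_draws bin_gt0.
by case/card_gt0P => A; rewrite inE => /andP[AU /eqP Ab]; exists A.
Qed.

(** Disjoint blocks of size [b] are cut off [U] one by one. Used in both coordinates, this amplifies
    the pseudoedges between small sets to a quadratic number between large ones. *)
Lemma block_sum (I : finType) (f : I -> nat) (b c k : nat) (U : {set I}) :
  (forall U0 : {set I}, U0 \subset U -> #|U0| = b -> c <= \sum_(i in U0) f i) ->
  k * b <= #|U| -> k * c <= \sum_(i in U) f i.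
Proof.
elim: k U => [|k IHk] U blockP kb; first by rewrite mul0n.
have bU : b <= #|U| by apply: leq_trans kb; rewrite mulSn leq_addr.
have [U0 U0U cU0] := subset_of_card bU.
rewrite mulSn (big_setID U0) /= (setIidPr U0U) leq_add ?blockP //.
apply: IHk => [U1 U1U|]; first by apply: blockP; apply: subset_trans U1U (subsetDl _ _).
by rewrite cardsD (setIidPr U0U) cU0 leq_subRL // -mulSn.
Qed.

(** Tuples are grouped by the pattern [kap v], which forgets exactly the entries in [X]. A forgotten
    entry has at most [#|X| - s] values within a group, a recorded one has a single value. Weighting
    the pattern symbols accordingly by [w] gives total weight [#|I| - s], and the sum over all
    patterns factors into a power. The set [Y] may vary with the group. *)
Lemma card_fibered (I : finType) (T s : nat) (X : {set I})
    (B : {set {ffun 'I_T -> I}}) :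
  s <= #|X| ->
  (forall v0, v0 \in B -> exists Y : {set I}, #|Y| + s <= #|X| /\
     forall v, v \in B ->
       (forall t, (v t \in X) = (v0 t \in X)) ->
       (forall t, v0 t \notin X -> v t = v0 t) ->
     forall t, v t \in X -> v t \in Y) ->
  #|B| <= (#|I| - s) ^ T.
Proof.
move=> sX fiberP.
pose kap (v : {ffun 'I_T -> I}) := [ffun t => if v t \in X then None else Some (v t)].
pose w (o : option I) : nat := if o is Some i then i \notin X else #|X| - s.
have sum_w : \sum_o w o = #|I| - s.
  rewrite sum_option /w; have -> : \sum_i (i \notin X : nat) = #|~: X|.
    by rewrite -sum1_card [RHS]big_mkcond /=; apply: eq_bigr => i _; rewrite inE; case: (_ \in _).
  by rewrite -(cardsC X) -addnBAC.
have -> : (#|I| - s) ^ T = \sum_(f : {ffun 'I_T -> option I}) \prod_t w (f t).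
  by rewrite -(bigA_distr_bigA (fun _ => w)) /= sum_w prod_nat_const card_ord.
rewrite -sum1_card (partition_big kap predT) //=; apply: leq_sum => f _.
rewrite sum1dep_card.
case: (set_0Vmem [set v in B | kap v == f]) => [->|[v0]]; first by rewrite cards0.
rewrite inE => /andP[v0B /eqP kv0]; have [Y [YX hY]] := fiberP _ v0B.
pose F t : {set I} := if f t is Some i then [set i] else Y.
have sub : [set v in B | kap v == f] \subset [set v | v \in family (fun t => mem (F t))].
  apply/subsetP => v; rewrite !inE => /andP[vB /eqP kv].
  have kk t : kap v t = kap v0 t by rewrite kv kv0.
  apply/familyP => t; rewrite /F -kv0 ffunE; case: ifP => [v0X|/negbT v0X].
    apply: (hY v vB) => [u|u v0u|].
    - by move: (kk u); rewrite !ffunE; do 2!case: ifP.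
    - by move: (kk u); rewrite !ffunE (negbTE v0u); case: ifP => // _ [].
    - by move: (kk t); rewrite !ffunE v0X; case: ifP.
  by move: (kk t); rewrite !ffunE (negbTE v0X) inE; case: ifP => // _ [->].
apply: leq_trans (subset_leq_card sub) _.
rewrite cardsE card_family foldrE big_map -big_enum /=.
apply: leq_prod => t _; rewrite /F -kv0 ffunE; case: ifP => [_|/negbT v0X] /=.
  by rewrite leq_subRL // addnC.
by rewrite v0X cards1.
Qed.

(** * Tree based graphs *)

Section RootedTrees.
Variables (V : finType) (T : rtree V).
Hypothesis wfT : rtree_wf T.

(** The least number of steps is taken because [rt_par] is unconstrained at the root, so later
    iterates may return to the root. *)
Lemma rtree_depth : exists depth : V -> nat, forall v, v \in rt_verts T ->
  iter (depth v) (rt_par T) v = rt_root T /\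
  forall k, iter k (rt_par T) v = rt_root T -> depth v <= k.
Proof.
apply: (fin_all_exists (P := fun v (k : nat) => v \in rt_verts T ->
  iter k (rt_par T) v = rt_root T /\
  forall k', iter k' (rt_par T) v = rt_root T -> k <= k')) => v.
case: (boolP (v \in rt_verts T)) => [vT|]; last by exists 0.
have ex : exists k, iter k (rt_par T) v == rt_root T.
  by have [_ [_ /(_ _ vT)[k <-]]] := wfT; exists k.
case: (ex_minnP ex) => k /eqP kr kmin; exists k => _; split=> // k' /eqP.
exact: kmin.
Qed.

Lemma on_root_path_verts l v : l \in rt_verts T -> on_root_path T l v -> v \in rt_verts T.
Proof.
move=> lT [k [-> kr]]; elim: k kr => //= k IHk kr.
have [_ [parT _]] := wfT; apply: parT; first by apply: IHk => j jk; apply: kr; apply: ltnW.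
by apply/eqP/kr.
Qed.

Lemma root_on_root_path l : l \in rt_verts T -> on_root_path T l (rt_root T).
Proof.
have [depth dP] := rtree_depth.
move=> /dP[dr dmin]; exists (depth l); split=> // j jd /dmin.
by rewrite leqNgt jd.
Qed.

Lemma leaf_on_root_path l v : l \in rt_verts T -> on_root_path T l v -> v \in leaves T -> v = l.
Proof.
move=> lT [[|k] [-> kr]] //=; rewrite inE => /andP[_ /eqP ch0].
suff : iter k (rt_par T) l \in children T (rt_par T (iter k (rt_par T) l)).
  by rewrite ch0 inE.
rewrite inE eqxx andbT; apply/andP; split; last by apply/eqP/kr.
by apply: (on_root_path_verts lT); exists k; split=> // j jk; apply/kr/ltnW.
Qed.

(** A deepest vertex with [v] on its way to the root is a leaf, since a child of it would be deeper
    by one. The minimality clause says that [v] is met no later than the root. *)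
Lemma leaf_below v : v \in rt_verts T -> exists2 l,
  l \in leaves T & exists2 k, iter k (rt_par T) l = v & forall k', iter k' (rt_par T) l = rt_root T -> k <= k'.
Proof.
move=> vT; have [depth dP] := rtree_depth.
pose P u := (u \in rt_verts T) && [exists k : 'I_(depth u).+1, iter k (rt_par T) u == v].
have Pv : P v by rewrite /P vT; apply/existsP; exists ord0.
case: (@arg_maxnP _ v P depth Pv) => l /andP[lT /existsP[k /eqP kv]] lmax.
exists l; last first.
  exists (val k) => // k' kr; have := ltn_ord k; rewrite ltnS => /leq_trans; apply.
  by have [_] := dP _ lT; exact.
rewrite inE lT /=; apply/eqP/setP => u; rewrite [RHS]inE; apply/negbTE/negP.
rewrite inE => /and3P[uT ur /eqP pu].
have [du dumin] := dP _ uT; have [dl dlmin] := dP _ lT.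
have dE : depth u = (depth l).+1.
  case E : (depth u) du => [|j] /= du; first by rewrite du eqxx in ur.
  apply/eqP; rewrite eqn_leq; apply/andP; split.
    by rewrite -E; apply: dumin; rewrite iterSr pu.
  by rewrite ltnS; apply: dlmin; rewrite -pu -iterSr.
suff Pu : P u by have := lmax _ Pu; rewrite /= dE ltnn.
rewrite /P uT /=; apply/existsP.
have kd : k.+1 < (depth u).+1 by rewrite dE ltnS.
by exists (Ordinal kd); rewrite /= -iterS iterSr pu; apply/eqP.
Qed.

(** A vertex is determined by a leaf below it and its distance from that leaf. *)
Lemma card_rtree_verts h : (forall l, l \in leaves T ->
    exists2 k, k < h & iter k (rt_par T) l = rt_root T) ->
  #|rt_verts T| <= #|leaves T| * h.
Proof.
move=> hP.
have sub : rt_verts T \subset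
    (fun p : V * 'I_h => iter p.2 (rt_par T) p.1) @: setX (leaves T) [set: 'I_h].
  apply/subsetP => v /leaf_below[l lT [k <- kmin]].
  have [k' k'h /kmin kk'] := hP l lT.
  by apply/imsetP; exists (l, Ordinal (leq_ltn_trans kk' k'h)); rewrite // in_setX lT inE.
apply: leq_trans (subset_leq_card sub) _.
by apply: leq_trans (leq_imset_card _ _) _; rewrite cardsX cardsT card_ord.
Qed.

End RootedTrees.

Section TreeBasedGraph.
Variables (V : finType) (m : nat) (T : 'I_m -> rtree V).
Hypothesis btbgT : is_btbg T.

Let wfT i : rtree_wf (T i). Proof. by case: btbgT. Qed.
Let root_inj : injective (fun i => rt_root (T i)).
Proof. by case: btbgT => _ [_ [_ []]]. Qed.

Lemma leaf_verts i l : l \in leaves (T i) -> l \in rt_verts (T i).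
Proof. by rewrite inE => /andP[]. Qed.

Lemma shared_leaf i j v : i != j -> v \in rt_verts (T i) -> v \in rt_verts (T j) ->
  v \in leaves (T i) /\ v \in leaves (T j).
Proof.
move=> ij vi vj; case: btbgT => _ [_ [_ [_ [_ /(_ i j ij)[_]]]]].
by apply; rewrite inE vi.
Qed.

Lemma card_shared i j : i != j -> #|rt_verts (T i) :&: rt_verts (T j)| <= 1.
Proof. by move=> ij; case: btbgT => _ [_ [_ [_ [_ /(_ i j ij)[]]]]]. Qed.

Lemma card_leaf_trees i l : l \in leaves (T i) -> #|[set j | l \in leaves (T j)]| = 2.
Proof.
move=> li; case: btbgT => _ [_ [_ [_ [leaf2 _]]]]; apply: leaf2.
by apply/bigcupP; exists i.
Qed.

Lemma leaf_two i j k l : i != j -> l \in leaves (T i) -> l \in leaves (T j) ->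
  l \in leaves (T k) -> k = i \/ k = j.
Proof.
move=> ij li lj lk.
have e2 : [set i; j] = [set k | l \in leaves (T k)].
  apply/eqP; rewrite eqEcard (card_leaf_trees li) cards2 ij andbT.
  by apply/subsetP => x; rewrite in_set2 in_set => /orP[] /eqP ->.
have : k \in [set i; j] by rewrite e2 in_set.
by rewrite in_set2 => /orP[] /eqP; [left|right].
Qed.

Lemma adjacentP i j : reflect (i != j /\ exists2 l, l \in leaves (T i) & l \in leaves (T j))
  (adjacent T i j).
Proof.
apply: (iffP andP) => -[ij]; first by case/existsP => l /andP[li lj]; split=> //; exists l.
by case=> l li lj; split=> //; apply/existsP; exists l; rewrite li.
Qed.

Lemma adjacent_sym i j : adjacent T i j = adjacent T j i.
Proof.
by apply/adjacentP/adjacentP => -[ij [l l1 l2]]; rewrite eq_sym; split=> //; exists l.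
Qed.

(** Every leaf of a tree lies in a second tree, and two trees share at most one vertex, so a tree
    has at most [m] leaves. *)
Lemma card_VH h : (forall i l, l \in leaves (T i) ->
    exists2 k, k < h & iter k (rt_par (T i)) l = rt_root (T i)) ->
  #|VH T| <= m * (m * h).
Proof.
move=> hP.
have cleaves i : #|leaves (T i)| <= m.
  have sub : leaves (T i) \subset \bigcup_(j | i != j) (rt_verts (T i) :&: rt_verts (T j)).
    apply/subsetP => l li.
    have /card_gt1P[j [k []]] : 1 < #|[set j | l \in leaves (T j)]|.
      by rewrite (card_leaf_trees li).
    rewrite !in_set => /andP[lj _] /andP[lk _] jk; apply/bigcupP.
    case: (eqVneq i j) => [ij|ij].
      by exists k; [rewrite ij | rewrite in_setI leaf_verts // lk].
    by exists j; rewrite // in_setI leaf_verts // lj.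
  apply: leq_trans (subset_leq_card sub) _.
  apply: (@leq_trans (\sum_(j | i != j) 1)); last first.
    by rewrite sum1_card -[leqRHS]card_ord max_card.
  elim/big_ind2: _ => [|x1 x2 y1 y2 h1 h2|j]; first by rewrite cards0.
    by rewrite (leq_trans (leq_card_setU _ _)) // leq_add.
  exact: card_shared.
apply: (@leq_trans (\sum_(i < m) m * h)); last by rewrite sum_nat_const card_ord.
rewrite /VH; elim/big_ind2: _ => [|x1 x2 y1 y2 h1 h2|i _]; first by rewrite cards0.
  by rewrite (leq_trans (leq_card_setU _ _)) // leq_add.
by apply: leq_trans (card_rtree_verts (wfT i) (hP i)) _; rewrite leq_mul2r cleaves orbT.
Qed.

(** [I] is the set of false roots. The root test comes first because a root may also be a leaf; thus
    [I] alone decides the roots, and all other values depend on [G] only. *)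
Definition pair_assignment (G : {set 'I_m * 'I_m}) (I : {set 'I_m}) (x : V) : bool :=
  if [pick i | rt_root (T i) == x] is Some i then i \notin I
  else (x \in LeavesH T) &&
    [forall p in G, ~~ ((x \in leaves (T p.1)) && (x \in leaves (T p.2)))].

(* If T_i is a single vertex, its leaf is the root t_i, so the clause C_{i,j}
   cannot be deleted without fixing t_i: such pairs have to be kept in G. *)
Definition root_leaf_pairs : {set 'I_m * 'I_m} :=
  [set p | adjacent T p.1 p.2 & rt_root (T p.1) \in leaves (T p.1) :&: leaves (T p.2)].

Lemma in_root_leaf_pairs i j : ((i, j) \in root_leaf_pairs) =
  [&& adjacent T i j, rt_root (T i) \in leaves (T i) & rt_root (T i) \in leaves (T j)].
Proof. by rewrite in_set in_setI. Qed.

(** The first index determines the second: the root of that tree, being a leaf, lies in only one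
    further tree. *)
Lemma card_root_leaf_pairs : #|root_leaf_pairs| <= m.
Proof.
rewrite -[leqRHS]card_ord -(card_in_imset (f := fun p : 'I_m * 'I_m => p.1) (D := mem root_leaf_pairs)).
  exact: max_card.
case=> i j [i' k]; rewrite !in_root_leaf_pairs => /and3P[/adjacentP[ij _] li lj].
move=> /and3P[/adjacentP[ik _] _ lk] /= ii'; rewrite -ii' in ik lk *.
case: (leaf_two ij li lj lk) => [ki|-> //].
by rewrite ki eqxx in ik.
Qed.

Lemma pair_assignment_root G I i : pair_assignment G I (rt_root (T i)) = (i \notin I).
Proof.
rewrite /pair_assignment; case: pickP => [j /eqP/root_inj -> //|/(_ i)].
by rewrite eqxx.
Qed.

Lemma pair_assignment_nonroot G I J x : x \notin RootsH T ->
  pair_assignment G I x = pair_assignment G J x.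
Proof.
move=> xR; rewrite /pair_assignment; case: pickP => // i /eqP ix.
by case/imsetP: xR; exists i.
Qed.

(** A root on the path belongs to a tree having [l] as a leaf, so it is in [I]. The only leaf on the
    path is [l], which is false because its pair is in [G]. Every other vertex is false by
    default. *)
Lemma pair_assignment_path (G : {set 'I_m * 'I_m}) (I : {set 'I_m}) l i v :
  (forall k, l \in leaves (T k) -> k \in I) ->
  (exists2 p, p \in G & (l \in leaves (T p.1)) && (l \in leaves (T p.2))) ->
  l \in leaves (T i) -> on_root_path (T i) l v -> pair_assignment G I v = false.
Proof.
move=> lI [p pG lp] li iv.
have vi := on_root_path_verts (wfT i) (leaf_verts li) iv.
have vl := leaf_on_root_path (wfT i) (leaf_verts li) iv.
rewrite /pair_assignment; case: pickP => [k /eqP kv|_].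
  apply/negbF/lI; case: (eqVneq k i) => [-> //|ki].
  have vk : v \in rt_verts (T k) by rewrite -kv; case: (wfT k).
  by have [lk /vl <-] := shared_leaf ki vk vi.
apply/negP => /andP[/bigcupP[k _ vk] /forall_inP/(_ _ pG)].
suff -> : v = l by rewrite lp.
apply: vl; case: (eqVneq i k) => [-> //|ik].
by case: (shared_leaf ik vi (leaf_verts vk)).
Qed.

(** A pair of [G] inside [I] falsifies its clause by the previous lemma. Conversely, a clause with
    both roots in [I] is satisfied by its shared leaf: by independence its pair is not in [G], and
    the leaf is no root because [G] contains [root_leaf_pairs]. *)
Lemma phi_pair_assignment (G : {set 'I_m * 'I_m}) (I : {set 'I_m}) :
  root_leaf_pairs \subset G -> (forall p, p \in G -> adjacent T p.1 p.2) ->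
  phi T (pair_assignment G I) <-> (forall p, p \in G -> ~~ ((p.1 \in I) && (p.2 \in I))).
Proof.
move=> degG GA; split=> [sat p pG|indep i j _ /adjacentP[ij [l li lj]]].
  apply/negP => /andP[p1I p2I].
  have /adjacentP[p12 [l l1 l2]] := GA _ pG.
  have lI k : l \in leaves (T k) -> k \in I by move=> /(leaf_two p12 l1 l2)[] ->.
  have [v [[l' [l'1 [l'2 l'v]]] vtrue]] : exists v, on_P T p.1 p.2 v /\ pair_assignment G I v.
    (* [phi] states each clause only for increasing indices, while [G] holds ordered pairs of either
       orientation. *)
    case: (ltngtP p.1 p.2) => [lt|lt|/ord_inj eq12]; last by rewrite eq12 eqxx in p12.
      exact: (sat _ _ lt (GA _ pG)).
    have := sat _ _ lt; rewrite adjacent_sym => /(_ (GA _ pG))[v [[l' [h2 [h1 h]]] vtrue]].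
    by exists v; split=> //; exists l'; split=> //; split=> //; case: h; [right|left].
  have l'l : l' = l.
    apply/eqP; have := card_shared p12; rewrite leqNgt; apply: contraNT => l'l.
    by apply/card_gt1P; exists l', l; rewrite !in_setI !leaf_verts.
  have onG : exists2 q, q \in G & (l \in leaves (T q.1)) && (l \in leaves (T q.2)).
    by exists p; rewrite // l1 l2.
  move: vtrue; rewrite l'l in l'v.
  by case: l'v => h; rewrite (pair_assignment_path lI onG _ h).
case: (boolP (i \in I)) => [iI|iI]; last first.
  exists (rt_root (T i)); rewrite pair_assignment_root; split=> //.
  by exists l; split=> //; split=> //; left; apply: (root_on_root_path (wfT i) (leaf_verts li)).
case: (boolP (j \in I)) => [jI|jI]; last first.
  exists (rt_root (T j)); rewrite pair_assignment_root; split=> //.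
  by exists l; split=> //; split=> //; right; apply: (root_on_root_path (wfT j) (leaf_verts lj)).
have adjij : adjacent T i j by apply/adjacentP; split=> //; exists l.
exists l; split.
  by exists l; split=> //; split=> //; left; exists 0; split.
rewrite /pair_assignment; case: pickP => [k /eqP kl|_].
  have lk : l \in leaves (T k).
    have lvk : l \in rt_verts (T k) by rewrite -kl; case: (wfT k).
    case: (eqVneq k i) => [-> //|ki]; by case: (shared_leaf ki lvk (leaf_verts li)).
  (* If [l] were the root of one of the two trees, the pair would be in [root_leaf_pairs], hence in
     [G], against independence. *)
  exfalso; case: (leaf_two ij li lj lk) => ki; rewrite ki in kl.
    have /(subsetP degG)/indep/= : (i, j) \in root_leaf_pairs by rewrite in_root_leaf_pairs adjij kl li.
    by rewrite iI jI.
  have /(subsetP degG)/indep/= : (j, i) \in root_leaf_pairs.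
    by rewrite in_root_leaf_pairs adjacent_sym adjij kl lj li.
  by rewrite iI jI.
apply/andP; split; first by apply/bigcupP; exists i.
apply/forall_inP => -[k k'] kG; apply/negP => /= /andP[lk lk'].
have /adjacentP[/= kk' _] := GA _ kG; move: (indep _ kG) => /=.
case: (leaf_two ij li lj lk) kk' => ->; case: (leaf_two ij li lj lk') => ->;
  by rewrite ?eqxx ?iI ?jI.
Qed.

End TreeBasedGraph.

(** * Segments of branching programs *)

Section Segments.
Variables (V W E : finType) (Z : nbp V W E).

Lemma walk_cat u p q v :
  walk Z u (p ++ q) v <-> exists2 w, walk Z u p w & walk Z w q v.
Proof.
elim: p u => [|e p IHp] u /=; first by split=> [|[w ->]] //; exists u.
split=> [[-> /IHp[w pw qv]]|[w [-> pw] qv]]; first by exists w.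
by split=> //; apply/IHp; exists w.
Qed.

Lemma walk_flatten (a : nat -> W) (p : nat -> seq E) r :
  (forall k, k < r -> walk Z (a k) (p k) (a k.+1)) ->
  walk Z (a 0) (flatten (mkseq p r)) (a r).
Proof.
elim: r => [|r IHr] ap //.
rewrite mkseqS -cats1 flatten_cat /= cats0; apply/walk_cat; exists (a r).
  by apply: IHr => k kr; apply: ap; apply: leqW.
exact: ap.
Qed.

Lemma lits_cat p q : lits Z (p ++ q) = lits Z p ++ lits Z q.
Proof. exact: pmap_cat. Qed.

Lemma var_count_cat x p q : var_count Z x (p ++ q) = var_count Z x p + var_count Z x q.
Proof. by rewrite /var_count lits_cat count_cat. Qed.

Lemma var_count_flatten x (p : nat -> seq E) r :
  var_count Z x (flatten (mkseq p r)) = \sum_(k < r) var_count Z x (p k).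
Proof.
elim: r => [|r IHr]; first by rewrite big_ord0.
by rewrite mkseqS -cats1 flatten_cat /= cats0 var_count_cat IHr big_ord_recr.
Qed.

Lemma mem_lits_flatten l (p : nat -> seq E) r :
  (l \in lits Z (flatten (mkseq p r))) = [exists k : 'I_r, l \in lits Z (p k)].
Proof.
elim: r => [|r IHr]; first by apply/esym/existsP => -[[]].
rewrite mkseqS -cats1 flatten_cat /= cats0 lits_cat mem_cat IHr.
apply/orP/existsP => [[/existsP[k lk]|lr]|[k]].
- by exists (widen_ord (leqnSn r) k).
- by exists ord_max.
case: (unliftP ord_max k) => [j ->|->]; last by right.
by rewrite lift_max => lj; left; apply/existsP; exists j.
Qed.

Lemma mem_lits_var_count l p : l \in lits Z p -> 0 < var_count Z l.1 p.
Proof. by move=> lp; rewrite -has_count; apply/hasP; exists l. Qed.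

Lemma mem_lits_Vars l p : l \in lits Z p -> l.1 \in Vars Z.
Proof.
rewrite mem_pmap => /mapP[e _ le]; rewrite inE; apply/existsP; exists e.
by rewrite -le.
Qed.

(** As an edge weighs at most 1, the prefix can grow until its weight is exactly [q] or the path is
    exhausted. *)
Lemma split_by_weight (f : seq E -> nat) q es :
  f [::] = 0 -> (forall p p', f (p ++ p') = f p + f p') -> (forall e, f [:: e] <= 1) ->
  exists es1 es2, [/\ es = es1 ++ es2, f es1 <= q & f es2 <= f es - q].
Proof.
move=> f0 fcat f1; elim: es q => [|e es IHes] q; first by exists [::], [::]; rewrite f0.
have fe : f (e :: es) = f [:: e] + f es by rewrite -fcat.
case: q => [|q].
  by exists [::], (e :: es); rewrite f0 subn0.
have [es1 [es2 [-> h1 h2]]] := IHes (q.+1 - f [:: e]).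
exists (e :: es1), es2; split=> //.
  by rewrite -cat1s fcat; have := f1 e; lia.
by rewrite -cat1s fcat; have := f1 e; lia.
Qed.

Lemma cut_walk (f : seq E -> nat) q r u es v :
  f [::] = 0 -> (forall p p', f (p ++ p') = f p + f p') -> (forall e, f [:: e] <= 1) ->
  walk Z u es v -> f es <= r.+1 * q ->
  exists (a : nat -> W) (p : nat -> seq E), [/\ a 0 = u, a r.+1 = v,
    forall k, k < r.+1 -> walk Z (a k) (p k) (a k.+1) /\ f (p k) <= q &
    flatten (mkseq p r.+1) = es].
Proof.
move=> f0 fcat f1; elim: r u es => [|r IHr] u es uv fr.
  exists (fun k => if k is 0 then u else v), (fun _ => es); split=> //.
    by case=> // _; rewrite mul1n in fr.
  by rewrite /= cats0.
have [es1 [es2 [esE h1 h2]]] := split_by_weight q es f0 fcat f1.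
move: uv; rewrite esE => /walk_cat[w uw wv].
have [|a [p [a0 ar ap pE]]] := IHr _ _ wv.
  by rewrite mulSn in fr; lia.
exists (fun k => if k is k'.+1 then a k' else u), (fun k => if k is k'.+1 then p k' else es1).
split=> //.
  by case=> [_|k kr] /=; [rewrite a0 | exact: ap].
by rewrite -pE /mkseq -[iota 0 r.+2]/(0 :: iota (1 + 0) r.+1) iotaDl map_cons -map_comp.
Qed.

Variables (d r : nat) (a : nat -> W).
Hypotheses (uniZ : uniform_read Z d) (a0 : a 0 = source Z) (ar : a r = sink Z).

(** Replacing segment [k] of [p] by that of [p'] yields another source-sink path. Uniformity gives
    [d] reads of [x] on both paths, and all other segments agree. Hence the cut vertices alone
    determine the reads in each segment. *)
Lemma segment_count (p p' : nat -> seq E) x k :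
  (forall k, k < r -> walk Z (a k) (p k) (a k.+1)) ->
  (forall k, k < r -> walk Z (a k) (p' k) (a k.+1)) ->
  x \in Vars Z -> k < r -> var_count Z x (p k) = var_count Z x (p' k).
Proof.
move=> ap ap' xZ kr; pose p2 j := if j == k then p' j else p j.
have ap2 j : j < r -> walk Z (a j) (p2 j) (a j.+1).
  by rewrite /p2; case: ifP => _; [apply: ap' | apply: ap].
have pd p0 : (forall k, k < r -> walk Z (a k) (p0 k) (a k.+1)) ->
    \sum_(k < r) var_count Z x (p0 k) = d.
  move=> /walk_flatten; rewrite a0 ar => p0Z.
  by rewrite -var_count_flatten; apply: uniZ.
have := pd _ ap; rewrite -(pd _ ap2) (bigD1 (Ordinal kr)) //= [RHS](bigD1 (Ordinal kr)) //=.
rewrite /p2 eqxx => /eqP; rewrite [X in _ == _ + X](eq_bigr (fun j : 'I_r => var_count Z x (p j))).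
  by rewrite eqn_add2r => /eqP.
move=> j jk; case: eqP => // jE; case/eqP: jk; exact: val_inj.
Qed.

(** The spliced path is computational because all its literals agree with the one total assignment
    [S]. *)
Lemma mixed_path (X : {set V}) (f : (V -> bool) -> Prop) (A : pred nat)
    (p p' : nat -> seq E) (S : V -> bool) :
  computes Z X f ->
  (forall k, k < r -> walk Z (a k) (p k) (a k.+1)) ->
  (forall k, k < r -> walk Z (a k) (p' k) (a k.+1)) ->
  (forall k l, k < r -> A k -> l \in lits Z (p k) -> S l.1 = l.2) ->
  (forall k l, k < r -> ~~ A k -> l \in lits Z (p' k) -> S l.1 = l.2) ->
  f S.
Proof.
move=> [_ fZ] ap ap' pS p'S; pose p2 k := if A k then p k else p' k.
have p2S l : l \in lits Z (flatten (mkseq p2 r)) -> S l.1 = l.2.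
  rewrite mem_lits_flatten => /existsP[k]; rewrite /p2.
  by case: ifP => [Ak|/negbT Ak]; [apply: pS | apply: p'S].
apply/fZ; exists (flatten (mkseq p2 r)); split=> //.
  rewrite /ss_path -a0 -ar; apply: walk_flatten => k kr; rewrite /p2.
  by case: ifP => _; [apply: ap | apply: ap'].
by move=> x [/p2S /= xt /p2S /= ]; rewrite xt.
Qed.

End Segments.

(** * Random tuples and sparse sets of pairs *)

Lemma card_two_values (K I : finType) (k k' : K) (i i' : I) : k != k' ->
  #|[set v : {ffun K -> I} | (v k == i) && (v k' == i')]| * (#|I| * #|I|) <= #|I| ^ #|K|.
Proof.
move=> kk'; set B := [set v | _].
(* Overwriting positions [k] and [k'] by arbitrary values is injective on [B], where these positions
   are prescribed. *)
pose h (y : {ffun K -> I} * (I * I)) : {ffun K -> I} :=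
  [ffun x => if x == k then y.2.1 else if x == k' then y.2.2 else y.1 x].
rewrite -card_prod -[#|{: I * I}|]cardsT -cardsX -card_ffun.
rewrite -(card_in_imset (f := h) (D := mem (setX B [set: I * I]))) ?max_card //.
move=> [v [c c']] [w [b b']]; rewrite !inE !andbT /= => /andP[/eqP vk /eqP vk'] /andP[/eqP wk /eqP wk'].
move/ffunP=> eqh; congr (_, (_, _)).
- apply/ffunP => x; move: (eqh x); rewrite !ffunE /=.
  by case: eqP => [-> _|_]; [rewrite vk wk|case: eqP => [-> _|//]; rewrite vk' wk'].
- by move: (eqh k); rewrite !ffunE eqxx.
- by move: (eqh k'); rewrite !ffunE eq_sym (negbTE kk') eqxx.
Qed.

(** Union bound over a pair of [G] and the two positions holding its ends; the positions are
    distinct since the ends are. *)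
Lemma card_hitting_pair (K I : finType) (G : {set I * I}) :
  (forall p, p \in G -> p.1 != p.2) ->
  #|[set v : {ffun K -> I} | [exists p in G,
       (p.1 \in [set v k | k : K]) && (p.2 \in [set v k | k : K])]]| * (#|I| * #|I|)
  <= #|K| * #|K| * #|G| * #|I| ^ #|K|.
Proof.
move=> Gneq; set B := [set v | _].
have sub : B \subset \bigcup_(y in setX [set kk : K * K | kk.1 != kk.2] G)
    [set v : {ffun K -> I} | (v y.1.1 == y.2.1) && (v y.1.2 == y.2.2)].
  apply/subsetP => v; rewrite inE => /exists_inP[p pG /andP[/imsetP[k _ pk] /imsetP[k' _ pk']]].
  apply/bigcupP; exists ((k, k'), p); last by rewrite inE /= -pk -pk' !eqxx.
  rewrite in_setX pG andbT inE /=; apply: contraNneq (Gneq _ pG) => kk'.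
  by rewrite pk pk' kk'.
apply: leq_trans (leq_mul (subset_leq_card sub) (leqnn _)) _.
have card_union (J : finType) (P : pred J) (F : J -> {set {ffun K -> I}}) c :
    (forall j, P j -> #|F j| * (#|I| * #|I|) <= c) ->
    #|\bigcup_(j | P j) F j| * (#|I| * #|I|) <= #|P| * c.
  move=> Fc; rewrite -[leqRHS]sum_nat_const.
  elim/big_ind2: _ => [|x1 x2 y1 y2 h1 h2|j]; rewrite ?cards0 //; last exact: Fc.
  apply: leq_trans (leq_mul (leq_card_setU _ _) (leqnn _)) _.
  by rewrite mulnDl leq_add.
apply: leq_trans (card_union _ _ _ (#|I| ^ #|K|) _) _.
  case=> [[k k'] p]; rewrite !inE /= => /andP[kk' _]; exact: card_two_values.
rewrite leq_mul2r; apply/orP; right.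
apply: (@leq_trans #|setX [set kk : K * K | kk.1 != kk.2] G|).
  by apply: subset_leq_card; apply/subsetP.
by rewrite cardsX leq_mul2r -card_prod max_card orbT.
Qed.

(** * The size bound for a given sparse set of pseudoedges *)

Section SizeBound.
Variables (V : finType) (m : nat) (T : 'I_m -> rtree V) (G : {set 'I_m * 'I_m}).
Variables (W E : finType) (Z : nbp V W E) (d q r s t : nat).
Hypotheses (btbgT : is_btbg T) (uniZ : uniform_read Z d).
Hypothesis compZ : computes Z (VH T) (phi T).
Hypotheses (rootG : root_leaf_pairs T \subset G).
Hypothesis adjG : forall p, p \in G -> adjacent T p.1 p.2.
Hypothesis hitG : forall U U' : {set 'I_m}, [disjoint U & U'] -> s <= #|U| -> s <= #|U'| ->
  exists2 p, p \in G & (p.1 \in U) && (p.2 \in U').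
(** [qr] allows a path with [d] reads of each root to be cut into [r.+1] segments of at most [q]
    root reads; [dq] and [ms] leave at least [2 * s] roots on both sides of a split; [tG] makes at
    least half of the tuples good. *)
Hypotheses (m_gt0 : 0 < m) (d_gt0 : 0 < d) (qr : d * m <= r.+1 * q) (dq : 2 * (d * q) <= m)
  (ms : 4 ^ d * (4 * s) <= m) (tG : 2 * (t * t * #|G|) <= m * m).

Let rootT i := rt_root (T i).

Let root_inj : injective rootT.
Proof. by case: btbgT => _ [_ [_ []]]. Qed.

Let root_Vars i : rootT i \in Vars Z.
Proof.
case: compZ => -> _; apply/bigcupP; exists i => //.
by case: btbgT => /(_ i)[].
Qed.

Let root_reads es := \sum_i var_count Z (rootT i) es.

Let root_reads_cat p p' : root_reads (p ++ p') = root_reads p + root_reads p'.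
Proof. by rewrite /root_reads -big_split; apply: eq_bigr => i _; rewrite var_count_cat. Qed.

Let root_reads_nil : root_reads [::] = 0.
Proof. by rewrite /root_reads big1. Qed.

Let root_reads_edge e : root_reads [:: e] <= 1.
Proof.
rewrite /root_reads /var_count /lits /=; case: (elab Z e) => [[x b]|] /=; last by rewrite big1.
have [i /eqP xi|none] := pickP (fun i => x == rootT i).
  rewrite (bigD1 i) //= big1 ?addn0 ?leq_b1 // => j ji.
  by rewrite xi (inj_eq root_inj) eq_sym (negbTE ji).
by rewrite big1 // => i _; rewrite none.
Qed.

Let range (v : {ffun 'I_t -> 'I_m}) : {set 'I_m} := [set v k | k : 'I_t].

Let good : {set {ffun 'I_t -> 'I_m}} :=
  [set v | ~~ [exists p in G, (p.1 \in range v) && (p.2 \in range v)]].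

Let path_data := ((nat -> W) * (nat -> seq E))%type.

Let cut_path (v : {ffun 'I_t -> 'I_m}) (ap : path_data) : Prop :=
  [/\ ap.1 0 = source Z, ap.1 r.+1 = sink Z,
      forall k, k < r.+1 -> walk Z (ap.1 k) (ap.2 k) (ap.1 k.+1),
      forall k, k < r.+1 -> root_reads (ap.2 k) <= q &
      forall k l, k < r.+1 -> l \in lits Z (ap.2 k) ->
        pair_assignment T G (range v) l.1 = l.2].

Let good_cut_path v : v \in good -> exists ap, cut_path v ap.
Proof.
rewrite inE => /exists_inPn vgood.
have /compZ.2[es [Zes _ vS]] : phi T (pair_assignment T G (range v)).
  by apply/phi_pair_assignment => //; apply: vgood.
have esq : root_reads es <= r.+1 * q.
  apply: leq_trans qr; rewrite /root_reads (eq_bigr (fun => d)) => [|i _].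
    by rewrite sum_nat_const card_ord mulnC.
  exact: uniZ.
have [a [p [a0 ar ap pE]]] :=
  cut_walk root_reads_nil root_reads_cat root_reads_edge Zes esq.
exists (a, p); split=> //= k; try by move=> /ap[].
move=> l kr lk; apply: vS; rewrite -pE mem_lits_flatten.
by apply/existsP; exists (Ordinal kr).
Qed.

(** All paths share the cut vertices, so they read each root equally often in each segment, and a
    single split of the segments serves the whole of [D]. The count is [card_fibered] with [X] the
    set of roots read on one side only. *)
Let fiber_bound (D : {set {ffun 'I_t -> 'I_m}}) (a : nat -> W)
    (p : {ffun 'I_t -> 'I_m} -> nat -> seq E) :
  (forall v, v \in D -> cut_path v (a, p v)) -> #|D| <= (m - s) ^ t.
Proof.
move=> Dcut; have [->|[v1 v1D]] := set_0Vmem D; first by rewrite cards0.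
have [a0 ar ap1 p1q _] := Dcut _ v1D; rewrite /= in a0 ar ap1 p1q.
have pE v i k : v \in D -> k < r.+1 ->
    var_count Z (rootT i) (p v k) = var_count Z (rootT i) (p v1 k).
  move=> /Dcut[_ _ /= apv _ _] kr.
  exact: (segment_count uniZ a0 ar apv ap1).
pose S i := [set k : 'I_r.+1 | 0 < var_count Z (rootT i) (p v1 k)].
(* Since [d] is positive, no [S i] is empty; an empty one would put [i] into both [U] and [U']. *)
have sumS i : \sum_(k < r.+1) var_count Z (rootT i) (p v1 k) = d.
  rewrite -var_count_flatten; apply: uniZ => //.
  by rewrite /ss_path -a0 -ar; apply: walk_flatten.
have S_gt0 i : exists k, k \in S i.
  apply/existsP; move: d_gt0; rewrite -(sumS i) lt0n; apply: contraNT.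
  rewrite negb_exists => /forallP none; apply/eqP/big1 => k _.
  by move: (none k); rewrite inE -eqn0Ngt => /eqP.
have Sd i : #|S i| <= d.
  rewrite -(sumS i) -sum1_card [leqRHS](bigID (mem (S i))) /=.
  by apply: leq_trans (leq_addr _ _); apply: leq_sum => k; rewrite inE.
have Sq k : #|[set i | k \in S i]| <= q.
  apply: leq_trans (p1q k (ltn_ord k)); rewrite /root_reads -sum1_card.
  rewrite [leqRHS](bigID (mem [set i | k \in S i])) /=.
  by apply: leq_trans (leq_addr _ _); apply: leq_sum => i; rewrite !inE.
have [A] := double_count_split Sd Sq; rewrite card_ord.
set U := [set i | _]; set U' := [set i | _] => AUU'.
have cardm (B : {set 'I_m}) : #|B| <= m by rewrite -[leqRHS]card_ord max_card.
(* By [dq] at least [m * m / 2] pairs survive, so [4 ^ d * B >= m / 2], which [ms] compares with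
   [2 * s]. *)
have half_m B B' : m * m - m * (d * q) <= 4 ^ d * (B * B') -> B' <= m -> 2 * s <= B.
  move=> BB' B'm; have : 4 ^ d * (2 * s) * m <= 4 ^ d * B * m.
    have : m * (2 * (d * q)) <= m * m by rewrite leq_mul2l dq orbT.
    have : 4 ^ d * (4 * s) * m <= m * m by rewrite leq_mul2r ms orbT.
    have : 4 ^ d * (B * B') <= 4 ^ d * B * m by rewrite mulnA leq_mul2l B'm orbT.
    by move: BB'; lia.
  by rewrite leq_pmul2r // leq_pmul2l // expn_gt0.
have sU : 2 * s <= #|U| := half_m _ _ AUU' (cardm U').
have sU' : 2 * s <= #|U'|.
  by apply: half_m (cardm U); rewrite [#|U'| * _]mulnC.
have disUU' : [disjoint U & U'].
  rewrite -setI_eq0; apply/eqP/setP => i; rewrite !inE; apply/negbTE/negP.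
  move=> /andP[/subsetP SA /subsetP SnA]; have [k kS] := S_gt0 i.
  by have := SnA k kS; rewrite inE SA.
(* Equality in the union bound is equivalent to disjointness. *)
have cardX : #|U :|: U'| = #|U| + #|U'| by apply/eqP; rewrite (leq_card_setU U U').
rewrite -[m in m - s]card_ord; apply: (@card_fibered _ _ _ (U :|: U')).
  by rewrite cardX; lia.
move=> v0 v0D.
(* [F] is the group of [v0], and [Y B] collects the roots of [B] that occur in tuples of the
   group. *)
pose F := [set v in D | [forall k, (v k \in U :|: U') == (v0 k \in U :|: U')] &&
   [forall (k | v0 k \notin U :|: U'), v k == v0 k]].
pose Y B := B :&: \bigcup_(v in F) range v.
have offX v i : v \in F -> i \notin U :|: U' -> (i \in range v) = (i \in range v0).
  rewrite in_set => /and3P[_ /forallP vX /forall_inP voff] iX.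
  apply/imsetP/imsetP => -[k _ ik]; exists k => //.
    by rewrite ik; apply/eqP/voff; rewrite -(eqP (vX k)) -ik.
  by rewrite ik; apply/esym/eqP/voff; rewrite -ik.
(* The exchange: [I] follows [v] on [U], [v'] on [U'] and the common entries elsewhere. The path
   made of the segments of [v] in [A] and those of [v'] outside [A] accepts its assignment, so [I]
   is independent in [G]. *)
have noG v v' i i' : v \in F -> v' \in F -> i \in U -> i \in range v ->
    i' \in U' -> i' \in range v' -> (i, i') \notin G.
  move=> vF v'F iU iv i'U' i'v'.
  pose I := (U :&: range v) :|: (U' :&: range v') :|: (range v0 :\: (U :|: U')).
  have IU j : j \in U -> (j \in I) = (j \in range v).
    move=> jU; have jU' : (j \in U') = false := disjointFr disUU' jU.
    by rewrite !in_setU in_setI in_setI in_setD in_setU jU jU' /= !orbF.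
  have IU' j : j \in U' -> (j \in I) = (j \in range v').
    move=> jU'; have jU : (j \in U) = false := disjointFl disUU' jU'.
    by rewrite !in_setU in_setI in_setI in_setD in_setU jU jU' /= !orbF.
  have IX j : j \notin U :|: U' -> (j \in I) = (j \in range v0).
    rewrite in_setU negb_or => /andP[/negbTE jU /negbTE jU'].
    by rewrite !in_setU in_setI in_setI in_setD in_setU jU jU'.
  have vD : v \in D by move: vF; rewrite in_set => /andP[].
  have v'D : v' \in D by move: v'F; rewrite in_set => /andP[].
  have [_ _ /= apv _ vS] := Dcut _ vD; have [_ _ /= apv' _ v'S] := Dcut _ v'D.
  have sat : phi T (pair_assignment T G I).
    apply: (mixed_path a0 ar (A := fun k => inord k \in A) compZ apv apv').
    - move=> k l kr kA lk; rewrite -(vS k l kr lk).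
      have [/imsetP[j _ lj]|lR] := boolP (l.1 \in RootsH T); last first.
        exact: pair_assignment_nonroot.
      rewrite lj !(pair_assignment_root btbgT); congr (~~ _).
      (* A root read in a segment of [A] is not in [U']; so it is in [U], where [I] follows [v], or
         outside both sets, where the whole group agrees. *)
      have [jX|jX] := boolP (j \in U :|: U'); last by rewrite IX // (offX v).
      have kS : inord k \in S j.
        by rewrite in_set inordK // -(pE v) // /rootT -lj; exact: mem_lits_var_count lk.
      have /negbTE jU' : j \notin U'.
        by rewrite in_set; apply/negP => /subsetP/(_ _ kS); rewrite in_setC kA.
      by apply: IU; move: jX; rewrite in_setU jU' orbF.
    - move=> k l kr kA lk; rewrite -(v'S k l kr lk).
      have [/imsetP[j _ lj]|lR] := boolP (l.1 \in RootsH T); last first.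
        exact: pair_assignment_nonroot.
      rewrite lj !(pair_assignment_root btbgT); congr (~~ _).
      have [jX|jX] := boolP (j \in U :|: U'); last by rewrite IX // (offX v').
      have kS : inord k \in S j.
        by rewrite in_set inordK // -(pE v') // /rootT -lj; exact: mem_lits_var_count lk.
      have /negbTE jU : j \notin U.
        by rewrite in_set; apply/negP => /subsetP/(_ _ kS); rewrite (negbTE kA).
      by apply: IU'; move: jX; rewrite in_setU jU.
  apply/negP => ii'G.
  have /(_ _ ii'G)/= := (phi_pair_assignment btbgT I rootG adjG).1 sat.
  by rewrite IU // iv IU' // i'v'.
(* Otherwise [hitG] would yield a pair of [G] between [Y U] and [Y U']. *)
have small : (#|Y U| < s) || (#|Y U'| < s).
  case: (ltnP #|Y U| s) => //= sY; case: (ltnP #|Y U'| s) => //= sY'; exfalso.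
  have disY : [disjoint Y U & Y U'].
    by apply: disjointWl (subsetIl _ _) _; apply: disjointWr (subsetIl _ _) _.
  have [[i i'] ii'G /= /andP[]] := hitG disY sY sY'.
  rewrite !in_setI => /andP[iU /bigcupP[v vF iv]] /andP[i'U' /bigcupP[v' v'F i'v']].
  by have := noG _ _ _ _ vF v'F iU iv i'U' i'v'; rewrite ii'G.
(* The side with fewer than [s] occurring roots has at least [2 * s] roots in all, so it misses at
   least [s] of them. *)
exists (Y U :|: Y U'); split.
  have YB B : #|Y B| <= #|B| := subset_leq_card (subsetIl _ _).
  have YUU' : #|Y U :|: Y U'| <= #|Y U| + #|Y U'| := (leq_card_setU _ _).1.
  rewrite cardX; apply: leq_trans (leq_add YUU' (leqnn s)) _.
  move: small (YB U) (YB U') sU sU'.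
  by move: #|Y U| #|Y U'| #|U| #|U'| => y y' u u' /orP[]; clear; lia.
move=> v vD vX voff k vkX.
have vF : v \in F.
  rewrite in_set vD /=; apply/andP; split; first by apply/forallP => k'; rewrite vX.
  by apply/forall_inP => k' /voff ->.
have vkF : v k \in \bigcup_(v in F) range v.
  by apply/bigcupP; exists v => //; apply: imset_f.
by rewrite in_setU !in_setI vkF !andbT -in_setU.
Qed.

(** At least half of the tuples are good. They are sorted by the [r.+2] vertices at which a chosen
    accepting path is cut, and [fiber_bound] limits each class. *)
Theorem nbp_size_bound : m ^ t <= 2 * (#|W| ^ r.+2 * (m - s) ^ t).
Proof.
have half_good : m ^ t <= 2 * #|good|.
  have bad_le := @card_hitting_pair 'I_t 'I_m G (fun p pG => (andP (adjG pG)).1).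
  have badE : ~: good = [set v : {ffun 'I_t -> 'I_m} | [exists p in G,
      (p.1 \in [set v k | k : 'I_t]) && (p.2 \in [set v k | k : 'I_t])]].
    by apply/setP => v; rewrite !inE negbK.
  rewrite -badE !card_ord in bad_le.
  have eq_mt : #|good| + #|~: good| = m ^ t by rewrite cardsC card_ffun !card_ord.
  have : 2 * #|~: good| * (m * m) <= m ^ t * (m * m).
    rewrite -mulnA (leq_trans (leq_mul (leqnn 2) bad_le)) // mulnA [leqRHS]mulnC.
    by rewrite leq_mul2r tG orbT.
  by rewrite leq_pmul2r ?muln_gt0 ?m_gt0 // -eq_mt; lia.
apply: leq_trans half_good _; rewrite leq_mul2l /=.
have [ap apP] : exists ap : {ffun 'I_t -> 'I_m} -> path_data,
    forall v, v \in good -> cut_path v (ap v).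
  apply: (fin_all_exists (P := fun v a => v \in good -> cut_path v a)) => v.
  have [/good_cut_path[a av]|] := boolP (v \in good); first by exists a.
  (* Tuples that are not good get arbitrary data. *)
  by exists (fun => source Z, fun => [::]).
pose cuts v := [ffun k : 'I_r.+2 => (ap v).1 k].
rewrite -[leqLHS]sum1_card (partition_big cuts predT) //=.
have -> : #|W| ^ r.+2 = #|{ffun 'I_r.+2 -> W}| by rewrite card_ffun card_ord.
rewrite -sum_nat_const; apply: leq_sum => c _; rewrite sum1dep_card.
apply: (fiber_bound (a := fun k => c (inord k)) (p := fun v => (ap v).2)) => v.
rewrite inE => /andP[vgood /eqP <-].
have [a0 ar apv vq vS] := apP v vgood.
have cE k : k < r.+2 -> cuts v (inord k) = (ap v).1 k by move=> kr; rewrite ffunE inordK.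
split=> /=; [by rewrite cE | by rewrite cE | | exact: vq | exact: vS].
by move=> k kr; rewrite !cE //; [exact: apv | exact: ltnW].
Qed.

End SizeBound.

(** * Sparse sets of pseudoedges from expansion *)

Lemma sparse_hitting_pairs (I : finType) (adj : rel I) (b c K s N : nat) :
  (forall U U' : {set I}, [disjoint U & U'] -> #|U| = b -> #|U'| = b ->
     c <= \sum_(i in U) \sum_(j in U') adj i j) ->
  K * b <= s ->
  2 ^ #|I| * 2 ^ #|I| * (#|I| * #|I| - K * (K * c)) ^ N < (#|I| * #|I|) ^ N ->
  exists G : {set I * I}, [/\ #|G| <= N, forall p, p \in G -> adj p.1 p.2 &
    forall U U' : {set I}, [disjoint U & U'] -> s <= #|U| -> s <= #|U'| ->
      exists2 p, p \in G & (p.1 \in U) && (p.2 \in U')].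
Proof.
move=> adjc Kb ltN.
pose S (u : {set I} * {set I}) := [set p | [&& adj p.1 p.2, p.1 \in u.1 & p.2 \in u.2]].
pose P (u : {set I} * {set I}) := [&& [disjoint u.1 & u.2], s <= #|u.1| & s <= #|u.2|].
(* The sets to hit are indexed by all pairs of vertex sets, which gives the factor
   [2 ^ #|I| * 2 ^ #|I|]. Splitting both sides into [K] blocks of size [b] shows that each has at
   least [K * (K * c)] elements. *)
have [||G GN GP] := @hitting_set _ _ P S (K * (K * c)) N.
- move=> [U U'] /and3P[/= dis sU sU'].
  have -> : #|S (U, U')| = \sum_(i in U) \sum_(j in U') adj i j.
    rewrite pair_big_dep /= -sum1_card /S [LHS]big_mkcond [RHS]big_mkcond.
    by apply: eq_bigr => -[i j] _; rewrite inE /=; case: (i \in U); case: (j \in U'); case: (adj i j).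
  apply: block_sum (leq_trans Kb sU) => U0 U0U U0b.
  rewrite exchange_big /=; apply: block_sum (leq_trans Kb sU') => U1 U1U U1b.
  rewrite exchange_big /=; apply: adjc => //.
  by apply: disjointWl U0U _; apply: disjointWr U1U _.
- rewrite !card_prod -[#|{: {set I}}|]cardsT -powersetT card_powerset cardsT.
  exact: ltN.
(* The sample was drawn from all pairs; only the adjacent ones are kept. *)
exists (G :&: [set p | adj p.1 p.2]); split.
- exact: leq_trans (subset_leq_card (subsetIl _ _)) GN.
- by move=> p; rewrite !inE => /andP[].
move=> U U' dis sU sU'; have [|p] := GP (U, U'); first by apply/and3P.
by rewrite inE => /and3P[adjp pU pU'] pG; exists p; rewrite ?inE ?pG ?pU.
Qed.

Section ReadCount.
Variables (V : finType) (m : nat) (T : 'I_m -> rtree V).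
Variables (W E : finType) (Z : nbp V W E) (d : nat).
Hypothesis uniZ : uniform_read Z d.
Hypothesis compZ : computes Z (VH T) (phi T).

(** With [d = 0] a source-sink path carries no literal, so the path accepting the all-true
    assignment would also accept the all-false one, which violates a clause. *)
Lemma read_count_gt0 i j : adjacent T i j -> 0 < d.
Proof.
move=> adjij; rewrite lt0n; apply/eqP => d0.
have [[k l] kl adjkl] : exists2 p : 'I_m * 'I_m, p.1 < p.2 & adjacent T p.1 p.2.
  case: (ltngtP i j) => [ij|ij|/val_inj ij]; first by exists (i, j).
    by exists (j, i); rewrite // adjacent_sym.
  by move: adjij; rewrite ij /adjacent eqxx.
have /compZ.2[es [Zes _ _]] : phi T (fun => true).
  move=> i' j' _ /adjacentP[_ [x xi xj]]; exists x; split=> //.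
  by exists x; split=> //; split=> //; left; exists 0; split.
have nolit x : x \notin lits Z es.
  apply/negP => xes; have := mem_lits_var_count xes.
  by rewrite (uniZ Zes (mem_lits_Vars xes)) d0.
have /(_ _ _ kl adjkl)[v []//] : phi T (fun => false).
  apply/compZ.2; exists es; split=> // x; first by case=> /negPn; rewrite nolit.
  by move/negPn; rewrite nolit.
Qed.

End ReadCount.

(** The sample is enlarged by [root_leaf_pairs], which costs at most [m] pairs; hence the [N + m] in
    the last hypothesis. A pseudomatching between two disjoint sets of size at least [b] also
    supplies the adjacent pair that forces [0 < d]. *)
Theorem nbp_size_bound_of_expansion (V : finType) (m : nat) (T : 'I_m -> rtree V)
    (W E : finType) (Z : nbp V W E) (d q r s t b c K N : nat) :
  is_btbg T -> uniform_read Z d -> computes Z (VH T) (phi T) ->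
  (forall U U' : {set 'I_m}, [disjoint U & U'] -> b <= #|U| -> b <= #|U'| ->
     exists M, pseudomatching_between T U U' M /\ c <= #|M|) ->
  0 < c -> 2 * b <= m -> K * b <= s ->
  2 ^ m * 2 ^ m * (m * m - K * (K * c)) ^ N < (m * m) ^ N ->
  0 < m -> d * m <= r.+1 * q -> 2 * (d * q) <= m -> 4 ^ d * (4 * s) <= m ->
  2 * (t * t * (N + m)) <= m * m ->
  m ^ t <= 2 * (#|W| ^ r.+2 * (m - s) ^ t).
Proof.
move=> btbgT uniZ compZ expT c_gt0 bm Kb ltN m_gt0 qr dq ms tN.
have expT' (U U' : {set 'I_m}) : [disjoint U & U'] -> #|U| = b -> #|U'| = b ->
    c <= \sum_(i in U) \sum_(j in U') adjacent T i j.
  move=> dis Ub U'b; have [||M [[MP _] cM]] := expT _ _ dis; rewrite ?Ub ?U'b //.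
  apply: leq_trans cM _; rewrite pair_big /= -sum1_card big_mkcond [leqRHS]big_mkcond /=.
  apply: leq_sum => p _; case: ifP => // /MP[-> -> ->] //.
have [G0 [G0N adjG0 hitG0]] : exists G : {set 'I_m * 'I_m},
   [/\ #|G| <= N, forall p, p \in G -> adjacent T p.1 p.2 &
    forall U U' : {set 'I_m}, [disjoint U & U'] -> s <= #|U| -> s <= #|U'| ->
      exists2 p, p \in G & (p.1 \in U) && (p.2 \in U')].
  by apply: (sparse_hitting_pairs expT' Kb); rewrite card_ord.
have [i [j adjij]] : exists i j, adjacent T i j.
  have bT : b <= #|[set: 'I_m]| by rewrite cardsT card_ord; lia.
  have [U _ Ub] := subset_of_card bT.
  have dis : [disjoint U & ~: U] by rewrite disjoints_subset setCK.
  have [||M [[MP _] cM]] := expT _ _ dis; rewrite ?Ub //.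
    by rewrite cardsCs setCK Ub card_ord; lia.
  have /card_gt0P[p /MP[_ _ adjp]] := leq_trans c_gt0 cM.
  by exists p.1, p.2.
have d_gt0 := read_count_gt0 uniZ compZ adjij.
apply: (@nbp_size_bound _ _ T (G0 :|: root_leaf_pairs T) _ _ Z d q r s t) => //.
- exact: subsetUr.
- by move=> p; rewrite in_setU => /orP[/adjG0 //|]; rewrite in_set => /andP[].
- move=> U U' dis sU sU'; have [p pG0 pUU'] := hitG0 _ _ dis sU sU'.
  by exists p; rewrite // in_setU pG0.
apply: leq_trans tN; rewrite leq_mul2l /= leq_mul2l; apply/orP; right.
apply: leq_trans (leq_card_setU _ _) _; rewrite leq_add //.
exact: card_root_leaf_pairs.
Qed.

(** * Choice of parameters *)

Lemma INR_addn a b : INR (a + b) = (INR a + INR b)%R.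
Proof. exact: plus_INR. Qed.

Lemma INR_muln a b : INR (a * b) = (INR a * INR b)%R.
Proof. exact: mult_INR. Qed.

Lemma INR_expn a b : INR (a ^ b) = (INR a ^ b)%R.
Proof. by elim: b => [|b IHb]; rewrite ?expn0 // expnS INR_muln IHb. Qed.

Lemma INR_leq a b : (a <= b)%N <-> (INR a <= INR b)%R.
Proof. by split=> [/leP/le_INR|/INR_le/leP]. Qed.

Lemma INR_ltn a b : (a < b)%N <-> (INR a < INR b)%R.
Proof. by split=> [/ltP/lt_INR|/INR_lt/ltP]. Qed.

Lemma nat_floor (x : R) : (0 <= x)%R -> exists n, (INR n <= x < INR n + 1)%R.
Proof.
move=> x0; have [n] := INR_unbounded x; elim: n => [/= ?|n IHn]; first lra.
rewrite S_INR => xn; have [/IHn //|nx] := Rlt_dec x (INR n).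
by exists n; lra.
Qed.

Lemma INR_divn_gt a b : (0 < b)%N -> (INR a / INR b - 1 < INR (a %/ b))%R.
Proof.
move=> b0; have /INR_ltn := ltn_ceil a b0; rewrite INR_muln S_INR => ab.
have b0' : (0 < INR b)%R by have /INR_ltn := b0.
apply: (Rmult_lt_reg_r (INR b)) => //.
by rewrite Rmult_minus_distr_r /Rdiv Rmult_assoc Rinv_l; lra.
Qed.

Local Open Scope R_scope.

Lemma pow_one_minus_le (x : R) k : 0 <= x <= 1 -> (1 - x) ^ k <= exp (- (x * INR k)).
Proof.
move=> x01; have -> : exp (- (x * INR k)) = exp (- x) ^ k.
  elim: k => [|k IHk]; first by rewrite Rmult_0_r Ropp_0 exp_0.
  by rewrite [RHS]/= -IHk -exp_plus S_INR; congr exp; ring.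
by apply: pow_incr; split; [lra | have := exp_ineq1_le (- x); lra].
Qed.

Lemma ln2_bounds : / 2 < ln 2 < 1.
Proof.
split; first exact: ln_lt_2.
rewrite -[X in _ < X]ln_exp; apply: ln_increasing; first lra.
by have := exp_ineq1 1; lra.
Qed.

Lemma Rle_div_intro a b c : 0 < b -> c * b <= a -> c <= a / b.
Proof.
by move=> b0 cb; apply: (Rmult_le_reg_r b) => //; rewrite /Rdiv Rmult_assoc Rinv_l; lra.
Qed.

Lemma Rdiv_le_intro a b c : 0 < b -> a <= c * b -> a / b <= c.
Proof.
by move=> b0 cb; apply: (Rmult_le_reg_r b) => //; rewrite /Rdiv Rmult_assoc Rinv_l; lra.
Qed.

Lemma INR2 : INR 2 = 2.
Proof. by rewrite /=; lra. Qed.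

Lemma sqr_le_exp4 d : (d * d <= 4 ^ d)%N.
Proof.
have d2 : (d <= 2 ^ d)%N by rewrite ltnW // ltn_expl.
by rewrite (leq_trans (leq_mul d2 d2)) // -expnMn.
Qed.

(** With [x = e / m ^ 2], the factor [(1 - x) ^ N] is at most [exp (- x N) <= exp (- 2 m)], and this
    beats [4 ^ m] because [ln 2 < 1]. *)
Lemma union_bound_counting (m e N : nat) : (0 < m)%N -> (0 < N)%N ->
  2 * INR m ^ 3 <= INR N * INR e ->
  (2 ^ m * 2 ^ m * (m * m - e) ^ N < (m * m) ^ N)%N.
Proof.
move=> m0 N0 Ne; have mm0 : (0 < m * m)%N by rewrite muln_gt0 m0.
(* Here the truncated difference is 0, and so is its power as [N] is positive. *)
have [em|em] := leqP (m * m) e.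
  have -> : (m * m - e = 0)%N by apply/eqP; rewrite subn_eq0.
  by rewrite exp0n // muln0 expn_gt0 mm0.
have mu0 : 0 < INR m by apply/(INR_ltn 0).
set mu := INR m in Ne mu0 *; have mu2 : 0 < mu * mu by nra.
pose x := INR e / (mu * mu).
have xE : x * (mu * mu) = INR e by rewrite /x; field; lra.
have x0 : 0 <= x by apply: Rle_div_intro => //; rewrite Rmult_0_l; apply: pos_INR.
have x1 : x <= 1.
  apply: Rdiv_le_intro => //; rewrite Rmult_1_l /mu -INR_muln; apply/INR_leq; exact: ltnW.
have xN : 2 * mu <= x * INR N.
  apply: (Rmult_le_reg_r (mu * mu)) => //.
  have -> : x * INR N * (mu * mu) = INR N * INR e by rewrite -xE; ring.
  by simpl in Ne; lra.
apply/INR_ltn; rewrite !INR_muln !INR_expn INR_muln INR2 -/mu.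
have -> : INR (m * m - e) = mu * mu * (1 - x).
  rewrite minus_INR; last by apply/leP/ltnW.
  by rewrite INR_muln -/mu -xE; ring.
rewrite Rpow_mult_distr.
have mmN : 0 < (mu * mu) ^ N by apply: pow_lt.
have two : 2 ^ m * 2 ^ m < exp (2 * mu).
  have -> : 2 ^ m = exp (mu * ln 2) by rewrite -Rpower_pow; [|lra].
  rewrite -exp_plus; apply: exp_increasing; have := ln2_bounds; nra.
have dec : (1 - x) ^ N <= exp (- (2 * mu)).
  apply: Rle_trans (pow_one_minus_le N (conj x0 x1)) _.
  have [lt|->] : x * INR N > 2 * mu \/ x * INR N = 2 * mu by lra.
    by apply/Rlt_le/exp_increasing; lra.
  exact: Rle_refl.
have pe := exp_pos (2 * mu); have pe' := exp_pos (- (2 * mu)).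
have ee : exp (2 * mu) * exp (- (2 * mu)) = 1.
  by rewrite -exp_plus -exp_0; congr exp; ring.
have pos2 : 0 < 2 ^ m by apply: pow_lt; lra.
have lt1 : 2 ^ m * 2 ^ m * (1 - x) ^ N < 1.
  apply: (Rle_lt_trans _ (2 ^ m * 2 ^ m * exp (- (2 * mu)))).
    by apply: Rmult_le_compat_l => //; nra.
  by rewrite -ee; apply: Rmult_lt_compat_r.
by nra.
Qed.

(** [B] will be [m ^ 0.999] and [P] a small power of [m]. With [D = 4 ^ d], the choices are about
    [b = B], [c = B / 3], [s = m / (4 D)], [K = s / b], [N = 2 m ^ 3 / (K ^ 2 c)], [t = P ^ 4],
    [r = 4 d ^ 2] and [q = d m / r], the last one for positive [d]. *)
Lemma exists_parameters (m d : nat) (P B : R) :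
  1000 <= P -> P <= B -> B * P ^ 12 <= INR m -> INR (4 ^ d) <= P ->
  exists b c K s N t q r : nat,
  [/\ (B <= INR b /\ INR c <= B / 3),
      [/\ (0 < c)%N, (2 * b <= m)%N, (K * b <= s)%N & (0 < m)%N],
      (2 ^ m * 2 ^ m * (m * m - K * (K * c)) ^ N < (m * m) ^ N)%N,
      [/\ (d * m <= r.+1 * q)%N, (2 * (d * q) <= m)%N, (4 ^ d * (4 * s) <= m)%N &
          (2 * (t * t * (N + m)) <= m * m)%N] &
      forall w : nat, (0 < w)%N -> (m ^ t <= 2 * (w ^ r.+2 * (m - s) ^ t))%N ->
        P <= ln (INR w)].
Proof.
move=> P1 PB Bm DP.
set D := (4 ^ d)%N in DP *; set mu := INR m in Bm *.
have D0 : (0 < D)%N by rewrite expn_gt0.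
have D1 : 1 <= INR D by apply: (le_INR 1); apply/leP.
have P2 : 1000 * P <= P ^ 2 by simpl; nra.
have P4 : P ^ 4 = P ^ 2 * P ^ 2 by ring.
have P2' : 1000000 <= P ^ 2 by nra.
have P4' : 1000000 * P ^ 2 <= P ^ 4 by nra.
have P8 : P ^ 8 = P ^ 4 * P ^ 4 by ring.
have P10 : P ^ 10 = P ^ 8 * P ^ 2 by ring.
have P12 : P ^ 12 = P ^ 10 * P ^ 2 by ring.
have P8' : P ^ 4 <= P ^ 8 by nra.
have P10' : 1000000 * P ^ 8 <= P ^ 10 by nra.
have P12' : 1000000 * P ^ 10 <= P ^ 12 by nra.
have mu12 : 1000 * P ^ 12 <= mu by nra.
have muB : 1000000 * B <= mu by nra.
have PP12 : 1000 * P <= P ^ 12 by lra.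
have muPB : 1000 * (P * B) <= mu.
  by have := Rmult_le_compat_r B _ _ (ltac:(lra)) PP12; lra.
have mu0 : 0 < mu by lra.
have m0 : (0 < m)%N by apply/(INR_ltn 0); exact: mu0.
have [b0 b0P] := nat_floor (Rle_trans 0 P B ltac:(lra) PB).
pose b := b0.+1; have bB : B <= INR b <= 2 * B by rewrite S_INR; lra.
have [c cP] : exists c, INR c <= B / 3 < INR c + 1 by apply: nat_floor; lra.
have cB : B / 6 <= INR c by lra.
pose s := (m %/ (4 * D))%N.
have INR4D : INR (4 * D) = 4 * INR D by rewrite INR_muln /=; ring.
have D8 : 8 * INR D <= mu by lra.
have sP : mu / (8 * INR D) <= INR s.
  have : 1 <= mu / (8 * INR D) by apply: Rle_div_intro; lra.
  have := @INR_divn_gt m (4 * D)%N; rewrite muln_gt0 D0 INR4D -/s -/mu => /(_ isT).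
  by have -> : mu / (4 * INR D) = 2 * (mu / (8 * INR D)) by [field; lra]; lra.
have DB : INR D * B <= P * B by apply: Rmult_le_compat_r; lra.
(* [s / b] is at least [2 * z]; as [z >= 1], rounding down leaves at least [z]. *)
pose z := mu / (32 * INR D * B).
have zE : z * (32 * INR D * B) = mu by rewrite /z; field; lra.
have DB0 : 0 < INR D * B by apply: Rmult_lt_0_compat; lra.
have z1 : 1 <= z by apply: Rle_div_intro; lra.
pose K := (s %/ b)%N.
have KP : z <= INR K.
  have : 2 * z <= INR s / INR b.
    apply: Rle_div_intro; first lra.
    apply: (Rle_trans _ (2 * z * (2 * B))); first by apply: Rmult_le_compat_l; lra.
    apply: Rle_trans sP; apply: Rle_div_intro; first lra.
    by apply: Req_le; rewrite -zE; ring.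
  by have := @INR_divn_gt s b (ltn0Sn _); rewrite -/K; lra.
pose e := (K * (K * c))%N.
(* This is [z ^ 2 * B / 6] with [B * P ^ 12 <= mu]; the constant is [32 ^ 2 * 6]. *)
have eP : mu * P ^ 12 / (6144 * INR D ^ 2) <= INR e.
  have D2 : 0 < INR D ^ 2 by apply: pow_lt; lra.
  apply: (Rle_trans _ (z * (z * (B / 6)))).
    apply: Rdiv_le_intro; first lra.
    have -> : z * (z * (B / 6)) * (6144 * INR D ^ 2) = z * (32 * INR D * B) * (32 * INR D * z).
      by field.
    rewrite zE; apply: Rmult_le_compat_l; first lra.
    apply: (Rmult_le_reg_r B); first lra.
    by have -> : 32 * INR D * z * B = mu by [rewrite -[RHS]zE; ring]; lra.
  rewrite /e !INR_muln; have := pos_INR c => c0.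
  by apply: Rmult_le_compat; [lra|apply: Rmult_le_pos; lra|lra|apply: Rmult_le_compat; lra].
have D2 : 0 < INR D ^ 2 <= P ^ 2 by split; [apply: pow_lt; lra|apply: pow_incr; lra].
have eP' : mu * P ^ 10 <= 6144 * INR e.
  have : mu * P ^ 12 / (6144 * INR D ^ 2) * (6144 * INR D ^ 2) = mu * P ^ 12 by field; lra.
  have : mu * P ^ 10 * INR D ^ 2 <= mu * P ^ 12.
    by rewrite P12 -Rmult_assoc; apply: Rmult_le_compat_l; [apply: Rmult_le_pos; lra|lra].
  move=> h1 h2; apply: (Rmult_le_reg_r (INR D ^ 2)); first lra.
  apply: Rle_trans h1 _; rewrite -h2.
  have -> : 6144 * INR e * INR D ^ 2 = INR e * (6144 * INR D ^ 2) by ring.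
  by apply: Rmult_le_compat_r => //; lra.
have e_gt0 : 0 < INR e by have := Rmult_lt_0_compat mu (P ^ 10) mu0 ltac:(lra); lra.
have mu3 : 0 < mu ^ 3 by apply: pow_lt; lra.
have [N0 N0P] : exists N0, INR N0 <= 2 * mu ^ 3 / INR e < INR N0 + 1.
  by apply: nat_floor; apply: Rle_div_intro => //; lra.
pose N := N0.+1.
have mu3E : 2 * mu ^ 3 / INR e * INR e = 2 * mu ^ 3 by field; lra.
pose v := mu ^ 2 / P ^ 10.
have vE : v * P ^ 10 = mu ^ 2 by rewrite /v; field; lra.
have NP : INR N <= 12288 * v + 1.
  rewrite S_INR; suff : 2 * mu ^ 3 / INR e <= 12288 * v by lra.
  apply: Rdiv_le_intro => //.
  have -> : 2 * mu ^ 3 = 2 * v * (mu * P ^ 10) by rewrite -[mu ^ 3]/(mu * mu ^ 2) -vE; ring.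
  have v0 : 0 <= v by apply: Rle_div_intro; [lra|nra].
  by nra.
(* Then [t ^ 2 * N] is of order at most [P ^ 8 * v = mu ^ 2 / P ^ 2], within the bound on the sample
   size. *)
have [t tP] : exists t, INR t <= P ^ 4 < INR t + 1 by apply: nat_floor; lra.
(* Quadratic [r] gives [d * q <= m / 4 + d <= m / 2]; the successor in [q] rounds up. *)
pose r := (4 * d * d)%N; pose q := ((d * m) %/ r.+1).+1.
exists b, c, K, s, N, t, q, r; split.
- by split; lra.
- split.
  + apply/INR_ltn; simpl; lra.
  + by apply/INR_leq; rewrite INR_muln INR2 -/mu; lra.
  + exact: leq_trunc_div.
  + exact: m0.
- apply: union_bound_counting => //.
  by rewrite -/mu -/e -mu3E S_INR; apply: Rmult_le_compat_r; lra.
- split.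
  + by rewrite [leqRHS]mulnC ltnW // ltn_ceil.
  + have d4 : (4 * d <= m)%N.
      have /INR_leq dD : (d <= D)%N by rewrite ltnW // ltn_expl.
      by apply/INR_leq; rewrite INR_muln -/mu (_ : INR 4 = 4); [lra | rewrite /=; lra].
    have := leq_trunc_div (d * m) r.+1; rewrite /q; move: (d * m %/ r.+1)%N => X.
    have [->|d0] := posnP d; first by rewrite mul0n muln0.
    have -> : (X * r.+1 = d * (4 * d * X) + X)%N by rewrite /r mulnS; lia.
    move=> h; have : (d * (4 * d * X) <= d * m)%N by lia.
    by rewrite leq_pmul2l //; lia.
  + by rewrite mulnA mulnC [(D * 4)%N]mulnC; exact: leq_trunc_div.
  + apply/INR_leq; rewrite !INR_muln INR_addn -/mu INR2.
    have t2 : INR t * INR t <= P ^ 8.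
      by rewrite P8; apply: Rmult_le_compat; try lra; apply: pos_INR.
    have v0 : 0 <= v by apply: Rle_div_intro; [lra|nra].
    have : INR t * INR t * (INR N + mu) <= P ^ 8 * (12288 * v + 1 + mu).
      by have := pos_INR N; have := pos_INR t; move=> *; apply: Rmult_le_compat; nra.
    have : 1000000 * (P ^ 8 * v) <= mu * mu.
      have -> : mu * mu = v * P ^ 10 by rewrite vE; ring.
      by nra.
    have h8 : 1000000 * P ^ 8 <= mu by lra.
    have : 1000000 * P ^ 8 * mu <= mu * mu by apply: Rmult_le_compat_r; lra.
    have : P ^ 8 * 1 <= P ^ 8 * mu by apply: Rmult_le_compat_l; lra.
    by lra.
move=> w w0 /INR_leq.
rewrite INR_muln INR_muln !INR_expn INR2 -/mu minus_INR -/mu; last first.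
  by apply/leP/leq_div.
have sm : INR s <= mu by apply/INR_leq; apply: leq_div.
pose x := INR s / mu; have xE : x * mu = INR s by rewrite /x; field; lra.
have x01 : 0 <= x <= 1.
  by split; [apply: Rle_div_intro => //; rewrite Rmult_0_l; apply: pos_INR | apply: Rdiv_le_intro; lra].
have -> : mu - INR s = mu * (1 - x) by rewrite -xE; ring.
(* If [ln w < P], the inequality gives [x * t <= ln 2 + r.+2 * ln w <= 1 + 6 P ^ 2], whereas
   [x >= 1 / (8 P)] makes [x * t] of order [P ^ 3]. *)
rewrite Rpow_mult_distr => hw; apply: Rnot_lt_le => wP.
have mut : 0 < mu ^ t by apply: pow_lt.
have w_gt0 : 0 < INR w by apply/(INR_ltn 0).
have wr : 0 < INR w ^ r.+2 by apply: pow_lt.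
have h1 : 1 <= 2 * INR w ^ r.+2 * exp (- (x * INR t)).
  apply: (Rle_trans _ (2 * INR w ^ r.+2 * (1 - x) ^ t)).
    apply: (Rmult_le_reg_r (mu ^ t)) => //; rewrite Rmult_1_l.
    move: hw; move: (INR w ^ r.+2) (mu ^ t) ((1 - x) ^ t) => A C F; lra.
  by apply: Rmult_le_compat_l; [lra | exact: pow_one_minus_le].
have wrE : INR w ^ r.+2 = exp (INR r.+2 * ln (INR w)) by rewrite -Rpower_pow.
have h2 : 0 <= ln 2 + INR r.+2 * ln (INR w) - x * INR t.
  have [//|neg] := Rle_or_lt 0 (ln 2 + INR r.+2 * ln (INR w) - x * INR t).
  have := exp_increasing _ _ neg; rewrite exp_0 /Rminus !exp_plus exp_ln -?wrE; lra.
have [_ ln21] := ln2_bounds.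
have rP : INR r.+2 <= 6 * P.
  (* From [d ^ 2 <= 4 ^ d = D] and [1 <= D]. *)
  have rD : (r.+2 <= 6 * D)%N by rewrite /r; have := sqr_le_exp4 d; rewrite -/D; lia.
  have := (INR_leq _ _).1 rD; rewrite INR_muln (_ : INR 6 = 6); first lra.
  by rewrite /=; lra.
have h3 : INR r.+2 * ln (INR w) <= 6 * P * P.
  apply: (Rle_trans _ (INR r.+2 * P)).
    by apply: Rmult_le_compat_l; [apply: pos_INR | lra].
  by apply: Rmult_le_compat_r; lra.
have xP : 1 <= x * (8 * P).
  have : mu <= INR s * (8 * INR D).
    apply: (Rle_trans _ (mu / (8 * INR D) * (8 * INR D))); first by apply: Req_le; field; lra.
    by apply: Rmult_le_compat_r; lra.
  rewrite -xE => h; apply: (Rle_trans _ (x * (8 * INR D))); last by apply: Rmult_le_compat_l; lra.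
  apply: (Rmult_le_reg_r mu) => //; rewrite Rmult_1_l.
  by apply: Rle_trans h _; apply: Req_le; ring.
have xt : P ^ 4 - 1 <= x * INR t * (8 * P).
  have -> : x * INR t * (8 * P) = x * (8 * P) * INR t by ring.
  apply: (Rle_trans _ (1 * INR t)); first lra.
  by apply: Rmult_le_compat_r; [apply: pos_INR | lra].
have big : x * INR t * (8 * P) <= (1 + 6 * P * P) * (8 * P).
  by apply: Rmult_le_compat_r; lra.
have P3 : P * P * P * 1000 <= P ^ 4.
  have -> : P ^ 4 = P * P * P * P by ring.
  by apply: Rmult_le_compat_l; [nra | lra].
have P3' : 1000 * P <= P * P * P by nra.
lra.
Qed.

(** The height is at most [m + 3], because [ln m <= m] and [4.9 * ln 2 > 1]. *)
Lemma card_VH_le_cubic (V : finType) (m : nat) (T : 'I_m -> rtree V) :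
  is_btbg T -> (forall i, height_le (T i) (log2 (INR m) / (49/10) + 3)) ->
  (#|VH T| <= m * (m * (m + 3)))%N.
Proof.
move=> btbgT heightT; apply: card_VH => // i l li.
have [k [kh kr]] := heightT i l li; exists k => //.
have m1 : 1 <= INR m by apply: (le_INR 1); apply/leP; apply: leq_ltn_trans (ltn_ord i).
apply/INR_leq; apply: Rle_trans kh _; rewrite INR_addn (_ : INR 3 = 3); last by rewrite /=; lra.
apply: Rplus_le_compat_r; have [ln2_half _] := ln2_bounds.
have lnm : ln (INR m) <= INR m.
  have := exp_ineq1_le (ln (INR m)); rewrite exp_ln; lra.
rewrite /log2; apply: Rdiv_le_intro; first lra.
by apply: Rdiv_le_intro; nra.
Qed.

Theorem theorem4 :
  exists alpha beta : R, (1 < alpha)%R /\ (0 < beta < 1)%R /\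
  exists N : nat,
    forall (V : finType) (m : nat) (T : 'I_m -> rtree V),
      is_btbg T -> pseudoexpander T ->
      (N <= #|VH T|)%N ->
      forall d : nat, (INR d <= log2 (INR #|VH T|) / 100000)%R ->
      forall (W E : finType) (Z : nbp V W E),
        nbp_wf Z -> uniform_read Z d -> computes Z (VH T) (phi T) ->
        (Rpower alpha (Rpower (INR #|VH T|) beta) <= INR #|W|)%R.
Proof.
(* [12500 * 8 / 100000 = 1], so [m >= M0] ensures [P >= 1000] below. *)
have [M0 M0P] := INR_unbounded (Rpower 1000 12500 + 4).
exists 2, (1 / 100000); split; first lra; split; first lra.
(* If [m < M0], the cubic bound would give at most [4 * M0 ^ 3] vertices. *)
exists (4 * (M0 * (M0 * M0))).+1%N => V m T btbgT [heightT expT] nN d dn W E Z _ uniZ compZ.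
have nm := card_VH_le_cubic btbgT heightT.
have M0m : (M0 <= m)%N.
  rewrite leqNgt; apply/negP => mM0.
  have le1 : (m * (m * (m + 3)) <= M0 * (M0 * (4 * M0)))%N.
    by apply: leq_mul; [lia | apply: leq_mul; lia].
  by have := leq_trans nN (leq_trans nm le1); lia.
set mu := INR m; set n := INR #|VH T| in dn *.
have muM : INR M0 <= mu by apply/INR_leq.
have pw0 : 0 < Rpower 1000 12500 by apply: exp_pos.
have mu4 : 4 <= mu by lra.
have n0 : 0 < n by apply/(INR_ltn 0); apply: leq_trans nN.
have n_mu : n <= mu ^ 4.
  apply: Rle_trans ((INR_leq _ _).1 nm) _.
  rewrite !INR_muln INR_addn (_ : INR 3 = 3) -/mu; last by rewrite /=; lra.
  have -> : mu ^ 4 = mu * (mu * (mu * mu)) by ring.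
  by do 2!(apply: Rmult_le_compat_l; first lra); nra.
have lnn : ln n <= 4 * ln mu.
  have mu4E : ln (mu ^ 4) = 4 * ln mu.
    by rewrite -Rpower_pow ?ln_Rpower; [rewrite /=; lra | lra].
  rewrite -mu4E; have [lt|->] : n < mu ^ 4 \/ n = mu ^ 4 by lra.
    by apply/Rlt_le/ln_increasing.
  exact: Rle_refl.
(* The exponent is the least that works for [4 ^ d <= n ^ (2 / 100000)] and [n <= m ^ 4]; also
   [B * P ^ 12 = m ^ 0.99996 <= m]. *)
pose P := Rpower mu (8 / 100000); pose B := Rpower mu (999 / 1000).
have [ln2_half ln2_1] := ln2_bounds.
have P1 : 1000 <= P.
  have -> : 1000 = Rpower (Rpower 1000 12500) (8 / 100000).
    by rewrite Rpower_mult (_ : 12500 * (8 / 100000) = 1) ?Rpower_1; lra.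
  by apply: Rle_Rpower_l; lra.
have PB : P <= B by apply: Rle_Rpower; lra.
have BP : B * P ^ 12 <= INR m.
  have -> : P ^ 12 = Rpower mu (96 / 100000).
    rewrite -Rpower_pow; last exact: exp_pos.
    by rewrite Rpower_mult; congr (Rpower mu); rewrite /=; lra.
  rewrite -Rpower_plus -[X in _ <= X]Rpower_1 -/mu; last lra.
  by apply: Rle_Rpower; lra.
have DP : INR (4 ^ d) <= P.
  rewrite INR_expn -Rpower_pow; last by rewrite /=; lra.
  have -> : INR 4 = 2 ^ 2 by rewrite /=; lra.
  have ln4 : ln (2 ^ 2) = 2 * ln 2.
    by rewrite -Rpower_pow ?ln_Rpower; [rewrite /=; lra | lra].
  have exp_le x y : x <= y -> exp x <= exp y.
    by case=> [/exp_increasing/Rlt_le //|->]; apply: Rle_refl.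
  apply: exp_le; rewrite ln4.
  have : INR d * ln 2 <= ln n / 100000.
    apply: (Rle_trans _ (log2 n / 100000 * ln 2)).
      by apply: Rmult_le_compat_r; lra.
    by apply: Req_le; rewrite /log2; field; lra.
  by lra.
have [b [c [K [s [N [t [q [r [bc [c0 bm Kb m0] ltN [qr dq ms tN] final]]]]]]]]] :=
  exists_parameters P1 PB BP DP.
have W0 : (0 < #|W|)%N by apply/card_gt0P; exists (source Z).
have expM (U U' : {set 'I_m}) : [disjoint U & U'] -> (b <= #|U|)%N -> (b <= #|U'|)%N ->
    exists M, pseudomatching_between T U U' M /\ (c <= #|M|)%N.
  move=> dis /INR_leq bU /INR_leq bU'.
  have [||M [MP cM]] := expT _ _ dis; rewrite -/mu -/B; try lra.
  by exists M; split=> //; apply/INR_leq; move: cM; rewrite -/mu -/B; lra.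
have Pw := final _ W0
  (nbp_size_bound_of_expansion btbgT uniZ compZ expM c0 bm Kb ltN m0 qr dq ms tN).
have nP : Rpower n (1 / 100000) <= P.
  apply: (Rle_trans _ (Rpower (mu ^ 4) (1 / 100000))).
    by apply: Rle_Rpower_l; lra.
  rewrite -Rpower_pow; last lra.
  by rewrite Rpower_mult; apply: Rle_Rpower; rewrite /=; lra.
have np0 : 0 < Rpower n (1 / 100000) by apply: exp_pos.
have w0 : 0 < INR #|W| by apply/(INR_ltn 0).
rewrite -[X in _ <= X]exp_ln //.
(* Here [n ^ beta <= P <= ln #|W|], and [ln 2 < 1] for the base [alpha = 2]. *)
have : Rpower n (1 / 100000) * ln 2 <= ln (INR #|W|) by nra.
case=> [/exp_increasing/Rlt_le|h]; first by [].
by rewrite {1}/Rpower h; apply: Rle_refl.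
Qed.
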